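(* Let $0<\alpha,\beta\le 1$. The function $\psi_{\alpha,\beta}(t,\tau)$ is a unilateral probability density in $\tau$, i.e. for every $t>0$ $$\psi_{\alpha,\beta}(t,\tau)\ge 0\ \ (\tau>0),\qquad \int_0^\infty\psi_{\alpha,\beta}(t,\tau)\,d\tau=1.$$
   Context: Kernels (principal branches of powers, $t,\tau>0$, any $c>0$): for $0<\alpha<1$, $f_\alpha(t,\tau)=\frac{1}{2\pi i}\int_{c-i\infty}^{c+i\infty}e^{z\tau-tz^\alpha}\,dz$; for $0<\beta<1$, $\varphi_\beta(t,\tau)=\frac{1}{2\pi i}\int_{c-i\infty}^{c+i\infty}z^{\beta-1}e^{zt-\tau z^\beta}\,dz$; and for $0<\alpha,\beta<1$ the subordination kernel is $\psi_{\alpha,\beta}(t,\tau)=\int_0^\infty\varphi_\beta(t,\sigma)f_\alpha(\sigma,\tau)\,d\sigma$. In the limiting cases $\psi_{\alpha,1}=f_\alpha$, $\psi_{1,\beta}=\varphi_\beta$ (for $\alpha,\beta<1$), and $\psi_{1,1}(t,\tau)=\delta(t-\tau)$ is the Dirac delta (understood as the unit point mass at $\tau=t$). *)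

(* Defs.v *)
From HB Require Import structures.
From mathcomp Require Import all_boot all_order all_algebra.
From mathcomp Require Import all_classical all_reals all_analysis.
From mathcomp Require Import complex.

Set Implicit Arguments.
Unset Strict Implicit.
Unset Printing Implicit Defensive.

Import Order.TTheory GRing.Theory Num.Theory.
Import numFieldNormedType.Exports.

Local Open Scope classical_set_scope.
Local Open Scope ring_scope.
Local Open Scope complex_scope.

Definition expc {R : realType} (z : R[i]) : R[i] :=
  let: x +i* y := z in (expR x * cos y) +i* (expR x * sin y).

(* Values in ]- pi, pi]; junk at 0. *)
Definition argc {R : realType} (z : R[i]) : R :=
  let a := acos (complex.Re z / ComplexField.Normc.normc z) in
  if 0 <= complex.Im z then a else - a.

Definition logc {R : realType} (z : R[i]) : R[i] :=
  ln (ComplexField.Normc.normc z) +i* argc z.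

(* Principal branch, for z != 0. *)
Definition powc {R : realType} (z : R[i]) (a : R) : R[i] :=
  expc (a%:C * logc z).

Definition cintegrable {R : realType} (D : set (measurableTypeR R))
    (g : R -> R[i]) : Prop :=
  (@lebesgue_measure R).-integrable D (fun x => (complex.Re (g x))%:E) /\
  (@lebesgue_measure R).-integrable D (fun x => (complex.Im (g x))%:E).

Definition cintegral {R : realType} (D : set (measurableTypeR R))
    (g : R -> R[i]) : R[i] :=
  Rintegral (@lebesgue_measure R) D (fun x => complex.Re (g x)) +i*
  Rintegral (@lebesgue_measure R) D (fun x => complex.Im (g x)).

(* (2 pi i)^-1 times the integral of g dz along the line z = c + i y, with
   dz = i dy. For the integrands below, with t, tau > 0, it converges
   absolutely: |exp (- t z^alpha)| = exp (- t |z|^alpha cos (alpha arg z)) and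
   |arg z| < pi / 2. So the Lebesgue integral is also the improper one. *)
Definition bromwich {R : realType} (c : R) (g : R[i] -> R[i]) : R[i] :=
  ((2 * pi)%:C * 'i%C)^-1 * cintegral setT (fun y => g (c +i* y) * 'i%C).

Definition f_kernel {R : realType} (c alpha t tau : R) : R[i] :=
  bromwich c (fun z => expc (z * tau%:C - t%:C * powc z alpha)).

Definition phi_kernel {R : realType} (c beta t tau : R) : R[i] :=
  bromwich c (fun z =>
    powc z (beta - 1) * expc (z * t%:C - tau%:C * powc z beta)).

Definition subordination_kernel {R : realType}
    (cf cphi alpha beta t tau : R) : R[i] :=
  cintegral `]0, +oo[
    (fun sigma => phi_kernel cphi beta t sigma * f_kernel cf alpha sigma tau).

(* A kernel in tau is a function of tau, except in the case alpha = beta = 1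
   where it is a measure on the tau-axis. *)
Inductive kernel_in_tau (R : realType) : Type :=
| Fun_kernel of R -> R[i]
| Meas_kernel of {measure set (measurableTypeR R) -> \bar R}.

Definition psi {R : realType} (cf cphi alpha beta t : R) : kernel_in_tau R :=
  if alpha == 1 then
    if beta == 1 then Meas_kernel (@dirac _ (measurableTypeR R) t R)
    else Fun_kernel (phi_kernel cphi beta t)
  else
    if beta == 1 then Fun_kernel (f_kernel cf alpha t)
    else Fun_kernel (subordination_kernel cf cphi alpha beta t).

(* In the order of R[i], 0 <= z says that z is real and nonnegative. *)
Definition kernel_nonneg {R : realType} (k : kernel_in_tau R) : Prop :=
  match k with
  | Fun_kernel g => forall tau : R, 0 < tau -> 0 <= g tau
  | Meas_kernel mu => forall A : set (measurableTypeR R),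
      measurable A -> A `<=` `]0, +oo[ -> (0 <= mu A)%E
  end.

Definition kernel_integral_eq1 {R : realType} (k : kernel_in_tau R) : Prop :=
  match k with
  | Fun_kernel g => cintegrable `]0, +oo[ g /\ cintegral `]0, +oo[ g = 1
  | Meas_kernel mu => mu `]0, +oo[%classic = 1%E
  end.

(* Main.v *)
Require Import Defs.
From mathcomp Require Import all_boot all_order all_algebra.
From mathcomp Require Import all_classical all_reals all_analysis.
From mathcomp Require Import measurable_realfun complex ring lra.

Set Implicit Arguments.
Unset Strict Implicit.
Unset Printing Implicit Defensive.

Import Order.TTheory GRing.Theory Num.Theory.
Import numFieldNormedType.Exports.

Local Open Scope classical_set_scope.
Local Open Scope ring_scope.

Local Notation Re := complex.Re.
Local Notation Im := complex.Im.
Local Notation normc := ComplexField.Normc.normc.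
Local Notation "x %:C" := (real_complex _ x).
Local Notation "x +i* y" := (Complex x y).
Local Notation "''i'" := (Complex 0 1).

(* The stable kernel f (of index a) is the inverse Fourier transform of
   h(y) = exp (- t (c + i y)^a), tilted by exp (c tau).  It does not depend on c,
   since d/dc and d/dy of the integrand agree up to a factor i and the integral of
   d/dy vanishes.  The same vanishing integral, i.e. an integration by parts, gives
   phi(t, tau) = t / (b tau) f(tau, t).
   Positivity of f: call m a positive multiplier if multiplication by m preserves
   the functions with nonnegative Fourier transform.  Characters exp (- i u y) are
   positive multipliers, which are closed under sums, products, nonnegative
   scalings and bounded limits, hence under exp.  The binomial series of
   1 - (1 - w)^a has nonnegative coefficients; with w = exp (- d z) and z = c + i y,
   exp (- t ((1 - exp (- d z)) / d)^a) is thus a positive multiplier, and d -> 0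
   gives h.  Applying h to exp (- e |y|), whose Fourier transform is explicit, and
   letting e -> 0 yields f >= 0.
   Total mass: summing with exp (- e |tau|) gives
   int_R exp (- x tau) f dtau = exp (- t x^a) for all x > 0; x -> oo shows that f
   puts no mass on tau <= 0, and x -> 0 that its mass is 1.
   The mass of phi follows by the substitution u = t tau^(- 1 / b), and that of psi
   by Tonelli's theorem. *)

(** * Complex powers on the right half-plane *)

(** The freedom in [c] takes the place of a contour shift: on the line through [x] the factors exp
    (x tau) and exp (- x tau) cancel, so the Laplace transform at [x] becomes Fourier inversion at
    the single point y = 0, where h equals exp (- t x^a). That inversion is carried out directly
    against exp (- e |tau|), whose transform is the Poisson kernel. The obstacle is that f is not
    known in advance to be integrable in [tau]: its defining integral only bounds it by a multiple
    of exp (c tau). Positivity therefore comes before normalization; it makes the limit e -> 0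
    monotone, and integrability comes out of the finite value of the limit. Positivity is stated for
    the action of multipliers on integrable functions because constants and characters have no
    Fourier transform that is a function. To speak of h itself, h is applied to exp (- e |y|), an
    integrable substitute for the constant 1. The shift c > 0 has a second use: it gives |exp (- d
    z)| < 1 on the whole line, so the binomial series is evaluated strictly inside its disc of
    convergence. *)

Section complex_algebra.
Context {R : realType}.
Implicit Types (z w : R[i]) (a b x y : R).

Lemma complex_eqP z w : Re z = Re w -> Im z = Im w -> z = w.
Proof. by case: z w => [a b] [c d] /= -> ->. Qed.

Lemma Re_mul z w : Re (z * w) = Re z * Re w - Im z * Im w.
Proof. by case: z w => [a b] [c d]. Qed.

Lemma Im_mul z w : Im (z * w) = Re z * Im w + Im z * Re w.
Proof. by case: z w => [a b] [c d]. Qed.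

Lemma Re_add z w : Re (z + w) = Re z + Re w.
Proof. by case: z w => [a b] [c d]. Qed.

Lemma Im_add z w : Im (z + w) = Im z + Im w.
Proof. by case: z w => [a b] [c d]. Qed.

Lemma Re_opp z : Re (- z) = - Re z.
Proof. by case: z. Qed.

Lemma Im_opp z : Im (- z) = - Im z.
Proof. by case: z. Qed.

Definition ReImE := (Re_add, Im_add, Re_opp, Im_opp, Re_mul, Im_mul).

Lemma realCM x y : (x * y)%:C = x%:C * y%:C :> R[i].
Proof. by apply: complex_eqP; rewrite !ReImE /=; ring. Qed.

Lemma realCD x y : (x + y)%:C = x%:C + y%:C :> R[i].
Proof. by apply: complex_eqP; rewrite !ReImE /=; ring. Qed.

Lemma realCN x : (- x)%:C = - x%:C :> R[i].
Proof. by apply: complex_eqP; rewrite !ReImE /=; ring. Qed.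

Lemma realCV x : (x^-1)%:C = (x%:C)^-1 :> R[i].
Proof. exact: fmorphV. Qed.

Lemma normc_ge0 z : 0 <= normc z.
Proof. by case: z => a b; exact: sqrtr_ge0. Qed.

Lemma normc_sqr z : normc z ^+ 2 = Re z ^+ 2 + Im z ^+ 2.
Proof. by case: z => a b /=; rewrite sqr_sqrtr// addr_ge0 ?sqr_ge0. Qed.

Lemma normcR x : normc x%:C = `|x|.
Proof. by rewrite /= expr0n/= addr0 sqrtr_sqr. Qed.

Lemma Re_le_normc z : `|Re z| <= normc z.
Proof.
rewrite -(ler_sqr (normr_ge0 _) (normc_ge0 _)) normc_sqr real_normK ?num_real//.
by rewrite lerDl sqr_ge0.
Qed.

Lemma Im_le_normc z : `|Im z| <= normc z.
Proof.
rewrite -(ler_sqr (normr_ge0 _) (normc_ge0 _)) normc_sqr real_normK ?num_real//.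
by rewrite lerDr sqr_ge0.
Qed.

Lemma normc_le_ReIm z : normc z <= `|Re z| + `|Im z|.
Proof.
rewrite -(ler_sqr (normc_ge0 _) (addr_ge0 _ _))// normc_sqr sqrrD.
rewrite !real_normK ?num_real// lerD2r lerDl mulrn_wge0// mulr_ge0//.
Qed.

Lemma normcX z n : normc (z ^+ n) = normc z ^+ n.
Proof.
elim: n => [|n ih]; first by rewrite !expr0 ComplexField.Normc.normc1.
by rewrite !exprS ComplexField.Normc.normcM ih.
Qed.

Lemma normc_gt0 z : 0 < Re z -> 0 < normc z.
Proof.
by move=> z0; apply: lt_le_trans (Re_le_normc z); rewrite normr_gt0 gt_eqF.
Qed.

Lemma Re_gt0_neq0 z : 0 < Re z -> z != 0.
Proof. by move=> z0; apply: contraTneq z0 => ->; rewrite ltxx. Qed.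

Lemma normc_sum_le (I : Type) (s : seq I) (F : I -> R[i]) :
  normc (\sum_(k <- s) F k) <= \sum_(k <- s) normc (F k).
Proof.
elim: s => [|k s ih]; rewrite ?big_nil ?ComplexField.Normc.normc0// !big_cons.
by rewrite (le_trans (le_normcD _ _))// lerD2l.
Qed.

Lemma Re_expc z : Re (expc z) = expR (Re z) * cos (Im z).
Proof. by case: z. Qed.

Lemma Im_expc z : Im (expc z) = expR (Re z) * sin (Im z).
Proof. by case: z. Qed.

Lemma expcD z w : expc (z + w) = expc z * expc w.
Proof.
case: z w => [a b] [c d]; apply: complex_eqP; rewrite ReImE /=.
  by rewrite expRD cosD; ring.
by rewrite expRD sinD; ring.
Qed.

Lemma expc0 : expc 0 = 1 :> R[i].
Proof. by apply: complex_eqP; rewrite /= expR0 ?cos0 ?sin0 mul1r. Qed.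

Lemma expc_neq0 z : expc z != 0.
Proof.
apply/eqP => e0; have := expcD z (- z); rewrite subrr expc0 e0 mul0r.
by move/eqP; rewrite oner_eq0.
Qed.

Lemma expcN z : expc (- z) = (expc z)^-1.
Proof.
apply: (mulfI (expc_neq0 z)); rewrite divff ?expc_neq0//.
by rewrite -expcD subrr expc0.
Qed.

Lemma normc_expc z : normc (expc z) = expR (Re z).
Proof.
case: z => a b /=; rewrite !exprMn -mulrDr cos2Dsin2 mulr1 sqrtr_sqr.
by rewrite ger0_norm// expR_ge0.
Qed.

Lemma expcR x : expc x%:C = (expR x)%:C.
Proof. by apply: complex_eqP; rewrite /= ?cos0 ?sin0 ?mulr1 ?mulr0. Qed.

Lemma ln_sqrt x : 0 < x -> ln (Num.sqrt x) = ln x / 2.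
Proof.
move=> x0; rewrite -{2}(sqr_sqrtr (ltW x0)) lnXn ?sqrtr_gt0//.
by rewrite mulr2n; lra.
Qed.

(** The case distinction on the sign of [Im z] hides the smoothness of the argument across the
    positive real axis. The [atan] form shows it, and yields both the derivative and the continuity
    of [logc]. *)
Lemma argc_atan z : 0 < Re z -> argc z = atan (Im z / Re z).
Proof.
case: z => a b /= a0; rewrite /argc /=.
have [tpi ttan] := atan_def (b / a).
have sE : a / Num.sqrt (a ^+ 2 + b ^+ 2) = cos (atan (b / a)).
  rewrite cos_atan.
  have -> : a ^+ 2 + b ^+ 2 = a ^+ 2 * (1 + (b / a) ^+ 2).
    by field; rewrite gt_eqF.
  by rewrite sqrtrM ?sqr_ge0// sqrtr_sqr gtr0_norm// invfM mulrA divff ?gt_eqF// mul1r.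
rewrite sE.
have pi0 := pi_gt0 R.
case: ifPn => [b0|].
  rewrite cosK// in_itv/= -{1}(atan0 R) le_atan/=; last by rewrite divr_ge0// ltW.
  by rewrite ltW// (lt_trans (atan_ltpi2 _))//; lra.
rewrite -ltNge => b0; rewrite -cosN cosK ?opprK// in_itv/= -atanN.
rewrite -{1}(atan0 R) le_atan/=; last by rewrite -mulNr divr_ge0 ?ltW// oppr_gt0.
by rewrite ltW// (lt_trans (atan_ltpi2 _))//; lra.
Qed.

Lemma logcE z : 0 < Re z ->
  logc z = (ln (Re z ^+ 2 + Im z ^+ 2) / 2) +i* atan (Im z / Re z).
Proof.
move=> z0; rewrite /logc argc_atan//; congr Complex.
case: z z0 => a b /= a0; rewrite ln_sqrt//.
by rewrite ltr_wpDr ?sqr_ge0// exprn_gt0.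
Qed.

Lemma expc_logc z : 0 < Re z -> expc (logc z) = z.
Proof.
move=> z0; have nz := normc_gt0 z0; rewrite /logc /= lnK ?posrE//.
have [_ ttan] := atan_def (Im z / Re z).
have c0 : cos (atan (Im z / Re z)) > 0.
  by rewrite cos_gt0_pihalf// atan_gtNpi2 atan_ltpi2.
have cE : cos (argc z) = Re z / normc z.
  rewrite argc_atan//; rewrite cos_atan; case: z z0 {nz ttan c0} => a b /= a0.
  have -> : a ^+ 2 + b ^+ 2 = a ^+ 2 * (1 + (b / a) ^+ 2).
    by field; rewrite gt_eqF.
  by rewrite sqrtrM ?sqr_ge0// sqrtr_sqr gtr0_norm// invfM mulrA divff ?gt_eqF// mul1r.
have sE : sin (argc z) = Im z / normc z.
  have -> : sin (argc z) = tan (argc z) * cos (argc z).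
    by rewrite /tan divfK// argc_atan// gt_eqF.
  rewrite cE argc_atan// ttan.
  by field; rewrite !gt_eqF.
by apply: complex_eqP; rewrite /= ?cE ?sE; field; rewrite gt_eqF.
Qed.

Lemma normc_powc z a : 0 < Re z -> normc (powc z a) = normc z `^ a.
Proof.
move=> z0; rewrite /powc normc_expc ReImE /= mul0r subr0.
by rewrite /powR gt_eqF ?normc_gt0.
Qed.

Lemma powcD z a b : powc z (a + b) = powc z a * powc z b.
Proof. by rewrite /powc -expcD -mulrDl realCD. Qed.

Lemma powc1 z : 0 < Re z -> powc z 1 = z.
Proof. by move=> z0; rewrite /powc rmorph1 mul1r expc_logc. Qed.

Lemma powc_neq0 z a : powc z a != 0.
Proof. exact: expc_neq0. Qed.

Lemma powcN z a : powc z (- a) = (powc z a)^-1.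
Proof. by rewrite /powc realCN mulNr expcN. Qed.

Lemma powcB1 z a : 0 < Re z -> powc z (a - 1) = powc z a / z.
Proof. by move=> z0; rewrite powcD powcN powc1. Qed.

Lemma Re_rM x z : Re (x%:C * z) = x * Re z.
Proof. by rewrite ReImE /= mul0r subr0. Qed.

Lemma Im_rM x z : Im (x%:C * z) = x * Im z.
Proof. by rewrite ReImE /= mul0r addr0. Qed.

Lemma logcM x z : 0 < x -> 0 < Re z -> logc (x%:C * z) = (ln x)%:C + logc z.
Proof.
move=> x0 z0.
rewrite !logcE ?Re_rM ?mulr_gt0// Im_rM; apply: complex_eqP; rewrite ReImE /=.
  rewrite !exprMn -mulrDr lnM ?posrE ?exprn_gt0//; last first.
    by rewrite ltr_wpDr ?sqr_ge0// exprn_gt0.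
  by rewrite lnXn// mulrDl mulr2n; lra.
by rewrite add0r -mulf_div divff ?gt_eqF// mul1r.
Qed.

Lemma powcM x z a : 0 < x -> 0 < Re z ->
  powc (x%:C * z) a = (x `^ a)%:C * powc z a.
Proof.
move=> x0 z0; rewrite /powc logcM// mulrDr expcD; congr (_ * _).
by rewrite -realCM expcR /powR gt_eqF.
Qed.

Lemma powcR x a : 0 < x -> powc x%:C a = (x `^ a)%:C.
Proof.
move=> x0; rewrite -[x%:C]mulr1 powcM//=.
rewrite /powc; suff -> : logc (1 : R[i]) = 0 by rewrite mulr0 expc0 mulr1.
rewrite logcE ?ltr01//=; apply: complex_eqP => /=.
  by rewrite expr1n expr0n/= addr0 ln1 mul0r.
by rewrite mul0r atan0.
Qed.

Lemma powc_conj x y a : 0 < x ->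
  powc (x +i* (- y)) a = Re (powc (x +i* y) a) +i* (- Im (powc (x +i* y) a)).
Proof.
move=> x0; rewrite /powc !logcE//= sqrrN mulNr atanN !mul0r !subr0 !addr0.
by rewrite mulrN cosN sinN mulrN.
Qed.


(** In the right half-plane |arg z| < pi / 2, so z^a has an angle of size at most a pi / 2, and cos
    is even and decreasing on [0, pi]. For a < 1 the constant is positive, which makes exp (- t z^a)
    decay along vertical lines. *)
Lemma Re_powc_ge z a : 0 < Re z -> 0 <= a <= 1 ->
  cos (a * (pi / 2)) * normc z `^ a <= Re (powc z a).
Proof.
move=> z0 /andP[a0 a1].
rewrite /powc /= !mul0r subr0 mulrC.
have -> : expR (a * ln (normc z)) = normc z `^ a.
  by rewrite /powR gt_eqF ?normc_gt0.
rewrite ler_wpM2l ?powR_ge0//= addr0 argc_atan//.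
set u := atan _.
have u1 : - (pi / 2) < u := atan_gtNpi2 (Im z / Re z).
have u2 : u < pi / 2 := atan_ltpi2 (Im z / Re z).
have pi0 := pi_gt0 R.
have -> : cos (a * u) = cos (a * `|u|).
  by case: (ger0P u) => // _; rewrite mulrN cosN.
have u3 : `|u| <= pi / 2 by rewrite ler_norml !ltW.
have au : a * `|u| <= a * (pi / 2) by rewrite ler_wpM2l.
have au0 : 0 <= a * `|u| by rewrite mulr_ge0.
have api : a * (pi / 2) <= pi.
  by apply: (@le_trans _ _ (1 * (pi / 2))); [rewrite ler_wpM2r//; lra|lra].
move: au; rewrite le_eqVlt => /predU1P[->//|au].
rewrite ltW// ltr_cos// in_itv/= ?au0 ?api ?andbT//; first by rewrite (le_trans (ltW au)).
by rewrite (le_trans au0)// ltW.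
Qed.

End complex_algebra.

(** * Derivatives of complex-valued functions of a real variable *)

Section complex_derivative.
Context {R : realType}.
Implicit Types (f g : R -> R[i]) (d z : R[i]) (x : R).

Lemma is_derive_mul (f g : R -> R) (x a b : R) :
  is_derive x 1 f a -> is_derive x 1 g b ->
  is_derive x 1 (fun u => f u * g u) (a * g x + f x * b).
Proof.
move=> fa gb; apply: is_derive_eq (is_deriveM fa gb) _.
by rewrite addrC /GRing.scale /= mulrC.
Qed.

Lemma is_derive_add (f g : R -> R) (x a b : R) :
  is_derive x 1 f a -> is_derive x 1 g b ->
  is_derive x 1 (fun u => f u + g u) (a + b).
Proof. by move=> fa gb; exact: is_deriveD. Qed.

Lemma is_derive_opp (f : R -> R) (x a : R) :
  is_derive x 1 f a -> is_derive x 1 (fun u => - f u) (- a).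
Proof. by move=> fa; exact: is_deriveN. Qed.

Lemma is_derive_comp (f g : R -> R) (x a b : R) :
  is_derive (g x) 1 f a -> is_derive x 1 g b ->
  is_derive x 1 (fun u => f (g u)) (a * b).
Proof. by move=> fa gb; exact: is_derive1_comp. Qed.

Lemma is_derive_continuous (f : R -> R) (x a : R) :
  is_derive x 1 f a -> {for x, continuous f}.
Proof.
by move=> fa; apply/differentiable_continuous/derivable1_diffP; exact: ex_derive.
Qed.

(** A derivative in a real variable, taken componentwise. Holomorphy enters only as the fact that
    the same chain rule holds along vertical and horizontal lines. *)
Definition cder f x d : Prop :=
  is_derive x 1 (fun u => Re (f u)) (Re d) /\
  is_derive x 1 (fun u => Im (f u)) (Im d).

Lemma cder_eq f x d d' : cder f x d -> d = d' -> cder f x d'.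
Proof. by move=> ? <-. Qed.

Lemma cder_ext f g x d : f =1 g -> cder f x d -> cder g x d.
Proof. by move=> /funext->. Qed.

Lemma cder_cst z x : cder (fun=> z) x 0.
Proof. by split; exact: is_derive_cst. Qed.

Lemma cder_real (f : R -> R) x (a : R) :
  is_derive x 1 f a -> cder (fun u => (f u)%:C) x a%:C.
Proof. by move=> fa; split => //=; exact: is_derive_cst. Qed.

Lemma cderD f g x d e : cder f x d -> cder g x e ->
  cder (fun u => f u + g u) x (d + e).
Proof.
move=> [fr fi] [gr gi]; split.
  rewrite Re_add; under eq_fun do rewrite Re_add; exact: is_derive_add.
rewrite Im_add; under eq_fun do rewrite Im_add; exact: is_derive_add.
Qed.

Lemma cderN f x d : cder f x d -> cder (fun u => - f u) x (- d).
Proof.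
move=> [fr fi]; split.
  rewrite Re_opp; under eq_fun do rewrite Re_opp; exact: is_derive_opp.
rewrite Im_opp; under eq_fun do rewrite Im_opp; exact: is_derive_opp.
Qed.

Lemma cderM f g x d e : cder f x d -> cder g x e ->
  cder (fun u => f u * g u) x (d * g x + f x * e).
Proof.
move=> [fr fi] [gr gi]; split.
  under eq_fun do rewrite Re_mul.
  apply: is_derive_eq
    (is_derive_add (is_derive_mul fr gr) (is_derive_opp (is_derive_mul fi gi))) _.
  by rewrite !ReImE; ring.
under eq_fun do rewrite Im_mul.
apply: is_derive_eq (is_derive_add (is_derive_mul fr gi) (is_derive_mul fi gr)) _.
by rewrite !ReImE; ring.
Qed.

Lemma cderZ z f x d : cder f x d -> cder (fun u => z * f u) x (z * d).
Proof.
move=> fd; apply: cder_eq; first exact: (cderM (cder_cst z x) fd).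
by rewrite mul0r add0r.
Qed.

Lemma cderX f x d n : cder f x d ->
  cder (fun u => f u ^+ n) x (n%:R * f x ^+ n.-1 * d).
Proof.
move=> fd; elim: n => [|n ih].
  by rewrite mul0r mul0r; exact: cder_cst.
apply: cder_ext (cder_eq (cderM fd ih) _) => [u|].
  by rewrite exprS.
by case: n {ih} => [|n] /=; rewrite ?exprS; ring.
Qed.

Lemma cder_sum (I : Type) (s : seq I) (F : I -> R -> R[i]) (D : I -> R[i]) x :
  (forall k, cder (F k) x (D k)) ->
  cder (fun u => \sum_(k <- s) F k u) x (\sum_(k <- s) D k).
Proof.
move=> h; elim: s => [|k s ih].
  rewrite big_nil; apply: cder_ext (cder_cst 0 x) => u; by rewrite big_nil.
rewrite big_cons; apply: cder_ext (cderD (h k) ih) => u; by rewrite big_cons.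
Qed.

Lemma cder_expc f x d : cder f x d ->
  cder (fun u => expc (f u)) x (d * expc (f x)).
Proof.
move=> [fr fi].
have der_e := is_derive_comp (is_derive_expR (Re (f x))) fr.
have der_c := is_derive_comp (is_derive_cos (Im (f x))) fi.
have der_s := is_derive_comp (is_derive_sin (Im (f x))) fi.
split.
  under eq_fun do rewrite Re_expc.
  apply: is_derive_eq (is_derive_mul der_e der_c) _.
  by rewrite Re_mul Re_expc Im_expc; ring.
under eq_fun do rewrite Im_expc.
apply: is_derive_eq (is_derive_mul der_e der_s) _.
by rewrite Im_mul Re_expc Im_expc; ring.
Qed.

Lemma cder_logc f x d : 0 < Re (f x) -> cder f x d ->
  cder (fun u => logc (f u)) x (d / f x).
Proof.
move=> f0 [fr fi].
have nf0 : \forall u \near x, 0 < Re (f u).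
  exact: (cvgr_gt _ (is_derive_continuous fr)).
set n2 := Re (f x) ^+ 2 + Im (f x) ^+ 2.
have n20 : 0 < n2 by rewrite ltr_wpDr ?sqr_ge0// exprn_gt0.
have dinv : Re (d / f x) = (Re d * Re (f x) + Im d * Im (f x)) / n2 /\
    Im (d / f x) = (Im d * Re (f x) - Re d * Im (f x)) / n2.
  rewrite /n2; case: (f x) => a b; case: d {fr fi} => p q /=.
  by split; ring.
case: dinv => dRe dIm.
split.
  apply: (@near_eq_is_derive _ _ _
    (fun u => ln (Re (f u) * Re (f u) + Im (f u) * Im (f u)) * 2^-1)).
  - by near=> u; rewrite logcE//=; near: u.
  have n2E : 0 < Re (f x) * Re (f x) + Im (f x) * Im (f x) by rewrite -!expr2.
  have Dn := is_derive_add (is_derive_mul fr fr) (is_derive_mul fi fi).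
  have Dl := is_derive_comp
    (g := fun u => Re (f u) * Re (f u) + Im (f u) * Im (f u)) (is_derive1_ln n2E) Dn.
  have D := is_derive_mul Dl (is_derive_cst (2^-1 : R) x 1).
  apply: is_derive_eq D _.
  rewrite dRe -!expr2 -/n2 /=; field; exact: lt0r_neq0.
apply: (@near_eq_is_derive _ _ _ (fun u => atan (Im (f u) * (Re (f u))^-1))).
- by near=> u; rewrite logcE//=; near: u.
have fx0 : Re (f x) != 0 by rewrite gt_eqF.
have Dq := is_derive_mul fi (is_deriveV fx0 fr).
have D := is_derive_comp (g := fun u => Im (f u) * (Re (f u))^-1)
  (is_derive1_atan _) Dq.
apply: is_derive_eq D _.
rewrite dIm /n2 /GRing.scale /=.
field.
by rewrite -/n2 !gt_eqF// addrC.
Unshelve. all: by end_near. Qed.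

Lemma cder_powc f x d (a : R) : 0 < Re (f x) -> cder f x d ->
  cder (fun u => powc (f u) a) x (a%:C * powc (f x) (a - 1) * d).
Proof.
move=> f0 fd; apply: cder_eq; first exact/cder_expc/cderZ/cder_logc/fd.
rewrite powcB1// /powc; field; exact: Re_gt0_neq0.
Qed.

Lemma cder_within_continuous f (df : R -> R[i]) (a b : R) :
  (forall r, a <= r <= b -> cder f r (df r)) ->
  {within `[a, b], continuous (fun u => Re (f u))} /\
  {within `[a, b], continuous (fun u => Im (f u))}.
Proof.
move=> h; split; apply: derivable_within_continuous => r; rewrite in_itv/= => /h[fr fi];
  exact: ex_derive.
Qed.

(** The mean value theorem has no complex-valued form with a single intermediate point. Applied to
    the two components separately, it costs the factor 2. *)
Lemma cder_normc_le f (df : R -> R[i]) (e : R) :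
  (forall r : R, 0 <= r <= 1 -> cder f r (df r)) ->
  (forall r : R, 0 <= r <= 1 -> normc (df r) <= e) ->
  normc (f 1 - f 0) <= e *+ 2.
Proof.
move=> h he; have [cr ci] := cder_within_continuous h.
have oo (r : R) : r \in `]0, 1[ -> 0 <= r <= 1.
  by rewrite in_itv/= => /andP[/ltW-> /ltW->].
apply: le_trans (normc_le_ReIm _) _; rewrite !ReImE mulr2n; apply: lerD.
  have [r /oo r01 ->] := MVT ltr01 (fun r hr => (h r (oo r hr)).1) cr.
  by rewrite subr0 mulr1 (le_trans (Re_le_normc _))// he.
have [r /oo r01 ->] := MVT ltr01 (fun r hr => (h r (oo r hr)).2) ci.
by rewrite subr0 mulr1 (le_trans (Im_le_normc _))// he.
Qed.

End complex_derivative.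

(** * Limits of complex sequences *)

Section complex_sequences.
Context {R : realType}.
Implicit Types (u v : nat -> R[i]) (l m : R[i]).

Definition ccvg u l : Prop :=
  Re (u n) @[n --> \oo] --> Re l /\ Im (u n) @[n --> \oo] --> Im l.

Lemma ccvg_cst l : ccvg (fun=> l) l.
Proof. by split; exact: cvg_cst. Qed.

Lemma ccvg_real (a : nat -> R) (b : R) : a n @[n --> \oo] --> b ->
  ccvg (fun n => (a n)%:C) b%:C.
Proof. by move=> ab; split => //=; exact: cvg_cst. Qed.

Lemma ccvgN u l : ccvg u l -> ccvg (fun n => - u n) (- l).
Proof.
move=> [ur ui]; split.
  by under eq_fun do rewrite Re_opp; rewrite Re_opp; exact: cvgN.
by under eq_fun do rewrite Im_opp; rewrite Im_opp; exact: cvgN.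
Qed.

Lemma ccvgM u v l m : ccvg u l -> ccvg v m -> ccvg (fun n => u n * v n) (l * m).
Proof.
move=> [ur ui] [vr vi]; split.
  by under eq_fun do rewrite Re_mul; rewrite Re_mul; apply: cvgB; exact: cvgM.
by under eq_fun do rewrite Im_mul; rewrite Im_mul; apply: cvgD; exact: cvgM.
Qed.

Lemma ccvg_expc u l : ccvg u l -> ccvg (fun n => expc (u n)) (expc l).
Proof.
move=> [ur ui].
have er : expR (Re (u n)) @[n --> \oo] --> expR (Re l).
  exact: continuous_cvg (@continuous_expR R _) ur.
have cr : cos (Im (u n)) @[n --> \oo] --> cos (Im l).
  exact: continuous_cvg (@continuous_cos R _) ui.
have sr : sin (Im (u n)) @[n --> \oo] --> sin (Im l).
  exact: continuous_cvg (@continuous_sin R _) ui.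
split.
  by rewrite Re_expc; under eq_fun do rewrite Re_expc; exact: cvgM.
by rewrite Im_expc; under eq_fun do rewrite Im_expc; exact: cvgM.
Qed.

Lemma ccvg_logc u l : (forall n, 0 < Re (u n)) -> 0 < Re l -> ccvg u l ->
  ccvg (fun n => logc (u n)) (logc l).
Proof.
move=> u0 l0 [ur ui].
have uE n : logc (u n) = (ln (Re (u n) ^+ 2 + Im (u n) ^+ 2) / 2) +i*
  atan (Im (u n) / Re (u n)) by exact: logcE.
split; rewrite logcE//; under eq_fun do rewrite uE; move=> /=.
  apply: cvgM; last exact: cvg_cst.
  apply: continuous_cvg.
    by apply: continuous_ln; rewrite ltr_wpDr ?sqr_ge0// exprn_gt0.
  by apply: cvgD; under eq_fun do rewrite expr2; rewrite expr2; exact: cvgM.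
apply: continuous_cvg; first exact: continuous_atan.
by apply: cvgM => //; apply: cvgV => //; rewrite gt_eqF.
Qed.

Lemma ccvg_powc u l (a : R) : (forall n, 0 < Re (u n)) -> 0 < Re l -> ccvg u l ->
  ccvg (fun n => powc (u n) a) (powc l a).
Proof.
by move=> u0 l0 ul; apply/ccvg_expc/ccvgM/ccvg_logc => //; exact: ccvg_cst.
Qed.

Lemma ccvg_normc_le u l (e : nat -> R) :
  (forall n, normc (u n - l) <= e n) -> e n @[n --> \oo] --> 0 -> ccvg u l.
Proof.
move=> ule e0; split; apply/cvgrPdist_le => /= d d0;
  move/cvgrPdist_le : e0 => /(_ d d0); apply: filterS => n; rewrite sub0r normrN => en;
  rewrite distrC.
- have := Re_le_normc (u n - l); rewrite ReImE Re_opp => h.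
  by rewrite (le_trans h)// (le_trans (ule n))// (le_trans (ler_norm _)).
- have := Im_le_normc (u n - l); rewrite ReImE Im_opp => h.
  by rewrite (le_trans h)// (le_trans (ule n))// (le_trans (ler_norm _)).
Qed.

End complex_sequences.

(** * Integrals over the real line *)

Section real_integrals.
Context {R : realType}.
Local Notation mu := (@lebesgue_measure R).
Local Notation integrableT f := (mu.-integrable setT (EFin \o f)).
Implicit Types (f g F : R -> R) (x : R).

Lemma integrableT_le f g : measurable_fun setT f -> (forall x, `|f x| <= g x) ->
  integrableT g -> integrableT f.
Proof.
move=> mf fg ig; apply: le_integrable ig => //; first exact/measurable_EFinP.
by move=> x _ /=; rewrite lee_fin (le_trans (fg x))// ler_norm.
Qed.

Lemma integrableT_continuous_le f g : continuous f -> (forall x, `|f x| <= g x) ->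
  integrableT g -> integrableT f.
Proof. by move=> cf fg; apply: integrableT_le fg; exact: continuous_measurable_fun. Qed.

Lemma continuous_measurable_EFin f : continuous f -> measurable_fun setT (EFin \o f).
Proof. by move=> cf; apply/measurable_EFinP; exact: continuous_measurable_fun. Qed.

Lemma integrableTD f g : integrableT f -> integrableT g ->
  integrableT (fun x => f x + g x).
Proof. by move=> fi gi; exact: (integrableD measurableT fi gi). Qed.

Lemma integrableTZ (k : R) f : integrableT f -> integrableT (fun x => k * f x).
Proof. by move=> fi; exact: (integrableZl measurableT k fi). Qed.

Lemma integrableT_measurable f : integrableT f -> measurable_fun setT f.
Proof. by move=> /integrableP[/measurable_EFinP]. Qed.

Lemma integrableT_ge0_eq f (l : R) : measurable_fun setT f -> (forall x, 0 <= f x) ->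
  (\int[mu]_x (f x)%:E = l%:E)%E -> integrableT f.
Proof.
move=> mf f0 fl; apply/integrableP; split; first exact/measurable_EFinP.
under eq_integral do rewrite /= ger0_norm//.
by rewrite fl ltry.
Qed.

Lemma dominated_cvgT (f_ : nat -> R -> R) f g :
  (forall n, measurable_fun setT (f_ n)) ->
  (forall x, f_ n x @[n --> \oo] --> f x) ->
  integrableT g -> (forall n x, `|f_ n x| <= g x) ->
  integrableT f /\ (\int[mu]_x f_ n x) @[n --> \oo] --> \int[mu]_x f x.
Proof.
move=> mf_ f_f ig f_g.
have mf : measurable_fun setT f.
  by apply: (measurable_fun_cvg (h := f_)) => // x _; exact: f_f.
have [||fi _ fcvg] := @dominated_convergence _ _ _ mu setT measurableT
  (fun n => EFin \o f_ n) (EFin \o f) (EFin \o g)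
  (fun n => (measurable_EFinP _ _).2 (mf_ n)) ((measurable_EFinP _ _).2 mf) _ ig.
- by apply: aeW => x _; apply: cvg_EFin; [exact: nearW|exact: f_f].
- by apply: aeW => x n _; rewrite lee_fin.
split=> //; apply: fine_cvg; rewrite fineK//.
exact: integrable_fin_num.
Qed.

Lemma ge0_even_FTC f F (l : R) : continuous f -> (forall x, 0 <= f `|x|) ->
  (forall x, is_derive x 1 F (f x)) -> F x @[x --> +oo] --> l ->
  (\int[mu]_x (f `|x|)%:E = (2 * (l - F 0))%:E)%E.
Proof.
move=> cf f0 dF Fl.
rewrite (ge0_symfun_integralT (f := fun x => f `|x|))//; first last.
- by move=> x /=; rewrite normrN.
- move=> x; apply: continuous_comp; [exact: norm_continuous|exact: cf].
rewrite -set_itvcy EFinM; congr (_ * _)%E.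
transitivity (\int[mu]_(x in `[0%R, +oo[) (f x)%:E)%E.
  by apply: eq_integral => x; rewrite inE/= in_itv/= andbT => x0; rewrite ger0_norm.
rewrite (ge0_continuous_FTC2y (F := F) _ _ Fl)//.
- by move=> x x0; rewrite -(ger0_norm x0).
- exact: continuous_subspaceT.
- by apply: cvg_at_right_filter; exact: is_derive_continuous.
- by move=> x _; rewrite derive1E; exact: derive_val.
Qed.

Lemma FTCT f F (l l' : R) : continuous f -> (forall x, is_derive x 1 F (f x)) ->
  integrableT f -> F n%:R @[n --> \oo] --> l -> F (- n%:R) @[n --> \oo] --> l' ->
  \int[mu]_x f x = l - l'.
Proof.
move=> cf dF fi Fl Fl'.
have [||||_ +] := @dominated_cvgT (fun n => f \_ `[- n%:R, n%:R]) f (fun x => `|f x|).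
- move=> n; apply: (iffLR (measurable_restrictT _ _)) => //.
  by apply: measurable_funTS; exact: continuous_measurable_fun.
- move=> x; apply: cvg_near_cst; near=> n.
  rewrite patchE mem_set//= in_itv/= -ler_norml.
  near: n; exact: nbhs_infty_ger.
- exact: integrable_norm.
- by move=> n x; rewrite patchE; case: ifP => // _; rewrite normr0.
under eq_fun => n do rewrite -Rintegral_mkcond.
move=> h.
(* The index is [n.+1] so that the endpoints are distinct, even for [n = 0]. *)
have FTCn n : \int[mu]_(x in `[- n.+1%:R, n.+1%:R]) f x = F n.+1%:R - F (- n.+1%:R).
  rewrite /Rintegral (@continuous_FTC2 _ f F)//.
  - by rewrite gtrN.
  - exact: continuous_subspaceT.
  - by split => //; [apply: cvg_at_right_filter|apply: cvg_at_left_filter];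
      exact: is_derive_continuous.
  - by move=> x _; rewrite derive1E; exact: derive_val.
have : \int[mu]_(x in `[- n.+1%:R, n.+1%:R]) f x @[n --> \oo] --> \int[mu]_x f x.
  by rewrite (cvg_shiftS (fun n => \int[mu]_(x in `[- n%:R, n%:R]) f x)).
under eq_fun do rewrite FTCn.
move/(cvg_lim (@Rhausdorff R)) => <-; apply/cvg_lim => //.
apply: cvgB.
  by rewrite (cvg_shiftS (fun n => F n%:R)).
by rewrite (cvg_shiftS (fun n => F (- n%:R))).
Unshelve. all: by end_near. Qed.

Lemma ge0_integralT_scale f (k : R) : 0 < k -> continuous f -> (forall x, 0 <= f x) ->
  (\int[mu]_x (f x)%:E = k%:E * \int[mu]_x (f (k * x))%:E)%E.
Proof.
move=> k0 cf f0.
have dk (x : R) : is_derive x 1 ( *%R k) k.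
  by apply: is_derive_eq (is_deriveZ k (is_derive_id x 1)) _; rewrite /GRing.scale/= mulr1.
have cfk : continuous (fun x => f (k * x)).
  by move=> x; apply: continuous_comp; [exact: mulrl_continuous|exact: cf].
have dk' : derive1 ( *%R k) = cst k.
  by apply/funext => x; rewrite derive1E derive_val.
rewrite (@increasing_ge0_integration_by_substitutionT _ ( *%R k))//.
- rewrite -ge0_integralZl//.
  + by apply: eq_integral => x _; rewrite dk'/= mulrC EFinM.
  + exact: (continuous_measurable_EFin cfk).
  + by move=> x _; rewrite lee_fin.
  + by rewrite lee_fin ltW.
- by move=> x y xy; rewrite ltr_pM2l.
- by rewrite dk'; move=> ?; exact: cvg_cst.
- by rewrite dk'; exact: is_cvg_cst.
- by rewrite dk'; exact: is_cvg_cst.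
- exact: gt0_cvgMrNy.
- exact: gt0_cvgMry.
Qed.

Lemma ge0_integralT_opp f : continuous f -> (forall x, 0 <= f x) ->
  (\int[mu]_x (f x)%:E = \int[mu]_x (f (- x))%:E)%E.
Proof.
move=> cf f0.
have cfN : continuous (f \o -%R).
  by move=> x; apply: continuous_comp; [exact: opp_continuous|exact: cf].
have split (g : R -> R) : continuous g -> (forall x, 0 <= g x) ->
    (\int[mu]_x (g x)%:E = \int[mu]_(x in `]-oo, 0%R]) (g x)%:E +
                          \int[mu]_(x in `[0%R, +oo[) (g x)%:E)%E.
  move=> cg g0; rewrite -integral_itv_obnd_cbnd; last first.
    by apply: measurable_funTS; exact: continuous_measurable_EFin.
  rewrite -ge0_integral_setU//=.
  - by rewrite -setCitvr setvU.
  - by rewrite -setCitvr setvU; exact: continuous_measurable_EFin.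
  - by move=> x _; rewrite lee_fin.
  - rewrite disj_set2E; apply/eqP; rewrite -subset0 => x/=.
    by rewrite !in_itv/= andbT leNgt => -[/negP].
rewrite (split f)// (split (f \o -%R))//; last by move=> x; exact: f0.
rewrite addeC; congr (_ + _)%E.
  rewrite -[in RHS]oppr0 (ge0_integration_by_substitutionNy (G := f \o -%R))//.
  - by apply: eq_integral => x _ /=; rewrite opprK.
  - exact: continuous_subspaceT.
  - by move=> x _; exact: f0.
rewrite -[in LHS]oppr0 (ge0_integration_by_substitutionNy (G := f))//.
exact: continuous_subspaceT.
Qed.

(** Passes from nonnegative integrands to signed ones: [f + |f|] and [|f|] are nonnegative,
    continuous and integrable, and their difference is [f]. *)
Lemma Rintegral_change (phi : R -> R) (k : R) : 0 < k -> continuous phi ->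
  (forall g, continuous g -> (forall x, 0 <= g x) ->
    (\int[mu]_x (g x)%:E = k%:E * \int[mu]_x (g (phi x))%:E)%E) ->
  forall f, continuous f -> integrableT f ->
  integrableT (fun x => f (phi x)) /\ \int[mu]_x f x = k * \int[mu]_x f (phi x).
Proof.
move=> k0 cphi H f cf fi.
have cc g : continuous g -> continuous (fun x => g (phi x)).
  by move=> cg x; apply: continuous_comp; [exact: cphi|exact: cg].
have H0 g : continuous g -> (forall x, 0 <= g x) -> integrableT g ->
    integrableT (fun x => g (phi x)) /\ \int[mu]_x g x = k * \int[mu]_x g (phi x).
  move=> cg g0 gi.
  have gphi0 : (0 <= \int[mu]_x (g (phi x))%:E)%E.
    by apply: integral_ge0 => x _; rewrite lee_fin.
  have gE := H g cg g0.
  have gl : (\int[mu]_x (g x)%:E < +oo)%E.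
    by apply: integrable_lty.
  have gphil : (\int[mu]_x (g (phi x))%:E < +oo)%E.
    move: gl; rewrite gE; case: (\int[mu]_x (g (phi x))%:E)%E => [r||//].
      by move=> _; exact: ltry.
    by rewrite gt0_muley// lte_fin.
  split.
    apply/integrableP; split; first exact: (continuous_measurable_EFin (cc _ cg)).
    by under eq_integral do rewrite /= ger0_norm//.
  rewrite /Rintegral gE fineM// ge0_fin_numE//.
have cn : continuous (fun x => `|f x|).
  by move=> x; apply: continuous_comp; [exact: cf|exact: norm_continuous].
have [ni nE] := H0 _ cn (fun x => normr_ge0 _) (integrable_norm fi).
have cp : continuous (fun x => f x + `|f x|) by move=> x; apply: cvgD; [exact: cf|exact: cn].
have p0 x : 0 <= f x + `|f x| by rewrite -lerBlDl sub0r -normrN ler_norm.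
have [pi pE] := H0 _ cp p0 (integrableTD fi (integrable_norm fi)).
have fphi : integrableT (fun x => f (phi x)).
  by apply: integrableT_continuous_le ni => //; exact: cc.
have E1 : \int[mu]_x (f x + `|f x|) = \int[mu]_x f x + \int[mu]_x `|f x|.
  by rewrite RintegralD//; exact: integrable_norm.
have E2 : \int[mu]_x (f (phi x) + `|f (phi x)|) =
    \int[mu]_x f (phi x) + \int[mu]_x `|f (phi x)|.
  by rewrite RintegralD.
split=> //; apply: (addIr (\int[mu]_x `|f x|)).
by rewrite -E1 pE E2 nE mulrDr.
Qed.

Lemma Rintegral_scale f (k : R) : 0 < k -> continuous f -> integrableT f ->
  integrableT (fun x => f (k * x)) /\ \int[mu]_x f x = k * \int[mu]_x f (k * x).
Proof.
move=> k0; apply: Rintegral_change => //; first exact: mulrl_continuous.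
by move=> g cg g0; exact: ge0_integralT_scale.
Qed.

Lemma Rintegral_odd f : continuous f -> integrableT f -> (forall x, f (- x) = - f x) ->
  \int[mu]_x f x = 0.
Proof.
move=> cf fi fodd.
have [] := @Rintegral_change -%R 1 ltr01 _ _ f cf fi.
  exact: opp_continuous.
  by move=> g cg g0; rewrite mul1e; exact: ge0_integralT_opp.
move=> _; under [in X in _ = X -> _]eq_Rintegral do rewrite fodd -mulN1r.
rewrite RintegralZl// mul1r mulN1r; set I := Rintegral _ _ _ => h; lra.
Qed.

Lemma Fubini_dominated (f : R -> R -> R) (a b : R -> R) :
  measurable_fun setT (fun z : R * R => f z.1 z.2) ->
  integrableT a -> integrableT b -> (forall x, 0 <= a x) -> (forall y, 0 <= b y) ->
  (forall x y, `|f x y| <= a x * b y) ->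
  \int[mu]_x (\int[mu]_y f x y) = \int[mu]_y (\int[mu]_x f x y).
Proof.
move=> mf ai bi a0 b0 fab.
pose F (z : R * R) : \bar R := (f z.1 z.2)%:E.
have mF : measurable_fun setT F by exact/measurable_EFinP.
have my x : measurable_fun setT (f x) by exact: (measurableT_comp mf (pair1_measurable x)).
have mx y : measurable_fun setT (fun x => f x y).
  exact: (measurableT_comp mf (pair2_measurable y)).
have iy x : integrableT (f x) by exact/integrableT_le/integrableTZ/bi.
have ix y : integrableT (fun x => f x y).
  apply: integrableT_le (integrableTZ (b y) ai) => // x.
  by rewrite mulrC.
have iF : (mu \x mu)%E.-integrable setT F.
  apply/integrable12ltyP => //.
  apply: (@le_lt_trans _ _ (\int[mu]_x ((a x)%:E * (\int[mu]_y b y)%:E))%E).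
    apply: ge0_le_integral => //=.
    - by move=> x _; exact: integral_ge0.
    - apply: (@measurable_fun_fubini_tonelli_F _ _ _ _ _ mu (abse \o F)) => //=.
      exact: measurableT_comp.
    - apply/measurable_EFinP/measurable_funM => //; exact: integrableT_measurable.
    - move=> x _; rewrite -EFinM -RintegralZl// /Rintegral fineK; last first.
        by apply: integrable_fin_num => //; exact: integrableTZ.
      apply: ge0_le_integral => //=.
      + exact: (measurable_int _ (integrable_norm (iy x))).
      + by apply/measurable_EFinP/measurable_funM => //; exact: integrableT_measurable.
      + by move=> y _; rewrite lee_fin.
  under eq_integral do rewrite -EFinM mulrC.
  exact/integrable_lty/integrableTZ.
have := Fubini iF; rewrite /F /=.
under eq_integral => x _ do rewrite -(fineK (integrable_fin_num _ (iy x)))//.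
under [in RHS]eq_integral => y _ do rewrite -(fineK (integrable_fin_num _ (ix y)))//.
by move=> h; rewrite {1}/Rintegral [in RHS]/Rintegral; congr fine.
Qed.

End real_integrals.

(** * The kernels as inverse Fourier transforms *)

Section kernel_integrand.
Context {R : realType}.
Local Notation mu := (@lebesgue_measure R).
Local Notation integrableT f := (mu.-integrable setT (EFin \o f)).

Lemma cder_continuous_Re (f : R -> R[i]) (df : R -> R[i]) :
  (forall y, cder f y (df y)) -> continuous (fun y => Re (f y)).
Proof. by move=> h y; exact: is_derive_continuous (h y).1. Qed.

Lemma cder_continuous_Im (f : R -> R[i]) (df : R -> R[i]) :
  (forall y, cder f y (df y)) -> continuous (fun y => Im (f y)).
Proof. by move=> h y; exact: is_derive_continuous (h y).2. Qed.

Lemma cder_vline (x y : R) : cder (fun v => x +i* v) y 'i.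
Proof. by split => /=; [exact: is_derive_cst|exact: is_derive_id]. Qed.

Lemma cder_hline (x y : R) : cder (fun u => u +i* y) x 1.
Proof. by split => /=; [exact: is_derive_id|exact: is_derive_cst]. Qed.

(** Common shape of the majorants on vertical lines, and the Poisson kernel after rescaling. Its
    integral [pi] cancels against the factor 1 / (2 pi) in the total mass. *)
Definition inv1Dsqr (y : R) : R := (1 + y ^+ 2)^-1.

Lemma inv1Dsqr_gt0 y : 0 < inv1Dsqr y.
Proof. by rewrite invr_gt0 ltr_wpDr ?sqr_ge0. Qed.

Lemma continuous_inv1Dsqr : continuous inv1Dsqr.
Proof.
move=> y; apply: cvgV; first by rewrite gt_eqF// ltr_wpDr ?sqr_ge0.
by apply: cvgD; [exact: cvg_cst|exact: exprn_continuous].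
Qed.

Lemma integral_inv1Dsqr : (\int[mu]_y (inv1Dsqr y)%:E = pi%:E)%E.
Proof.
transitivity (\int[mu]_y (inv1Dsqr `|y|)%:E)%E.
  by apply: eq_integral => y _; rewrite /inv1Dsqr real_normK ?num_real.
rewrite (ge0_even_FTC (F := atan) continuous_inv1Dsqr _ _ (@cvgy_atan R)).
- by rewrite atan0 subr0 mulrC divfK.
- by move=> y; rewrite ltW// inv1Dsqr_gt0.
Qed.

Lemma integrable_inv1Dsqr : integrableT inv1Dsqr.
Proof.
apply: integrableT_ge0_eq integral_inv1Dsqr.
- exact: continuous_measurable_fun continuous_inv1Dsqr.
- by move=> y; rewrite ltW// inv1Dsqr_gt0.
Qed.

Lemma cvg_inv1Dsqr : inv1Dsqr n%:R @[n --> \oo] --> (0 : R).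
Proof.
apply: (@squeeze_cvgr _ _ _ _ (fun=> 0) (fun n => n%:R^-1)).
- near=> n; have n0 : (0 < n)%N by near: n; exact: nbhs_infty_gt.
  rewrite ltW ?inv1Dsqr_gt0//= /inv1Dsqr lef_pV2 ?posrE ?ltr0n ?ltr_wpDr ?sqr_ge0//.
  have := sqr_ge0 (n%:R - 2^-1 : R); set x := n%:R : R; nra.
- exact: cvg_cst.
- have n0 : \forall n \near \oo, 0 < (n%:R : R).
    by near=> n; rewrite ltr0n; near: n; exact: nbhs_infty_gt.
  exact: (gtr0_cvgV0 n0).2 (@cvgr_idn R).
Unshelve. all: by end_near. Qed.

(* [u = k r^a] and [exp (u a / 2) >= u a / 2], raised to the power [2 / a]. *)
Lemma sqr_expR_powR_le (k a r : R) : 0 < k -> 0 < a -> 0 < r ->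
  r ^+ 2 * expR (- (k * r `^ a)) <= ((k * a / 2) `^ (2 / a))^-1.
Proof.
move=> k0 a0 r0; set K := k * a / 2.
have K0 : 0 < K by rewrite /K !mulr_gt0.
rewrite expRN -ler_pdivlMr ?invr_gt0 ?expR_gt0// invrK mulrC ler_pdivlMr ?powR_gt0//.
have -> : expR (k * r `^ a) = expR (K * r `^ a) `^ (2 / a).
  rewrite -expRM; congr expR; rewrite /K; field; exact: lt0r_neq0.
apply: (@le_trans _ _ ((K * r `^ a) `^ (2 / a))).
  rewrite powRM ?powR_ge0 ?(ltW K0)// -powRrM mulrC.
  have -> : a * (2 / a) = 2%:R by field; exact: lt0r_neq0.
  by rewrite powR_mulrn// (ltW r0).
apply: ge0_ler_powR.
- by rewrite divr_ge0// ltW.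
- by rewrite nnegrE mulr_ge0 ?powR_ge0// ltW.
- by rewrite nnegrE expR_ge0.
- by apply: le_trans (expR_ge1Dx _); rewrite lerDr.
Qed.

(** The exponential beats |z|^(-2), and 1 + (Im z)^2 <= (1 + x0^(-2)) |z|^2 because Re z >= x0. One
    [K] serves the whole half-plane Re z >= x0, which differentiation in the abscissa [c]
    requires. *)
Lemma expR_normc_powR_le (k a x0 : R) : 0 < k -> 0 < a -> 0 < x0 ->
  exists2 K, 0 < K & forall z : R[i], x0 <= Re z ->
    expR (- (k * normc z `^ a)) <= K * inv1Dsqr (Im z).
Proof.
move=> k0 a0 x00.
set K := ((k * a / 2) `^ (2 / a))^-1.
have K0 : 0 < K by rewrite invr_gt0 powR_gt0// !mulr_gt0.
exists ((1 + x0 ^- 2) * K) => [|z xz].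
  by rewrite mulr_gt0// addr_gt0 ?invr_gt0 ?exprn_gt0.
have z0 : 0 < Re z by exact: lt_le_trans xz.
have nz := normc_gt0 z0.
have h := @sqr_expR_powR_le k a (normc z) k0 a0 nz.
rewrite /inv1Dsqr ler_pdivlMr ?ltr_wpDr ?sqr_ge0// mulrC.
apply: (@le_trans _ _ ((1 + x0 ^- 2) * (normc z ^+ 2 * expR (- (k * normc z `^ a))))).
  rewrite mulrA ler_wpM2r ?expR_ge0// mulrDl mul1r addrC lerD//.
    by rewrite normc_sqr lerDr sqr_ge0.
  rewrite mulrC ler_pdivlMr ?exprn_gt0// mul1r.
  rewrite (le_trans _ (_ : Re z ^+ 2 <= _))//; last by rewrite normc_sqr lerDl sqr_ge0.
  by rewrite lerXn2r// nnegrE ltW.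
by rewrite ler_wpM2l// addr_ge0// invr_ge0 exprn_ge0// ltW.
Qed.

Definition kerH (a t tau : R) (z : R[i]) : R[i] :=
  expc (z * tau%:C - t%:C * powc z a).

(** The logarithmic derivative of [kerH] in [z]. *)
Definition kerW (a t tau : R) (z : R[i]) : R[i] :=
  tau%:C - (t * a)%:C * powc z (a - 1).

(** The velocity [d] is ['i] on a vertical line and 1 on a horizontal one. The two instances
    together are the Cauchy-Riemann relation that makes the kernel independent of the abscissa. *)
Lemma cder_kerH (a t tau : R) (f : R -> R[i]) (x : R) (d : R[i]) :
  0 < Re (f x) -> cder f x d ->
  cder (fun u => kerH a t tau (f u)) x (d * kerW a t tau (f x) * kerH a t tau (f x)).
Proof.
move=> f0 fd; apply: cder_eq.
  apply: cder_expc; apply: cderD; first exact: cderM fd (cder_cst _ _).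
  by apply: cderN; apply: cderZ; exact: cder_powc fd.
by rewrite /kerW /kerH realCM; ring.
Qed.

Lemma cder_kerW (a t tau : R) (f : R -> R[i]) (x : R) (d : R[i]) :
  0 < Re (f x) -> cder f x d ->
  exists e, cder (fun u => kerW a t tau (f u)) x e.
Proof.
move=> f0 fd; eexists; apply: cderD; first exact: cder_cst.
by apply: cderN; apply: cderZ; exact: cder_powc fd.
Qed.

(** The principal branch commutes with conjugation. Hence the imaginary part is odd in [y] and
    integrates to 0, so the kernels are real. *)
Lemma kerH_conj (a t tau x y : R) : 0 < x ->
  kerH a t tau (x +i* (- y)) =
  Re (kerH a t tau (x +i* y)) +i* (- Im (kerH a t tau (x +i* y))).
Proof.
move=> x0; rewrite /kerH powc_conj//.
set w := powc _ _.
have -> : (x +i* - y) * tau%:C - t%:C * (Re w +i* - Im w) =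
    Re ((x +i* y) * tau%:C - t%:C * w) +i* - Im ((x +i* y) * tau%:C - t%:C * w).
  by apply: complex_eqP; rewrite !ReImE /=; ring.
by apply: complex_eqP; rewrite !(Re_expc, Im_expc)/= ?cosN ?sinN ?mulrN.
Qed.

Section bounds.
Variables (a t : R).
Hypotheses (a01 : 0 < a < 1) (t0 : 0 < t).

Lemma cos_angle_gt0 : 0 < cos (a * (pi / 2)).
Proof.
have /andP[a0 a1] := a01; have pi0 := pi_gt0 R.
by apply: cos_gt0_pihalf; apply/andP; split; nra.
Qed.

Lemma normc_kerH_le tau (z : R[i]) : 0 < Re z ->
  normc (kerH a t tau z) <=
  expR (Re z * tau) * expR (- (t * cos (a * (pi / 2)) * normc z `^ a)).
Proof.
move=> z0; have /andP[a0 a1] := a01.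
have zE (w : R[i]) : Re (z * tau%:C - t%:C * w) = Re z * tau - t * Re w.
  by rewrite !ReImE /= mulr0 mul0r !subr0.
rewrite normc_expc -expRD ler_expR zE.
rewrite lerD2l lerN2 -mulrA ler_pM2l// Re_powc_ge// !ltW//.
Qed.

Lemma normc_kerH_maj tau x0 : 0 < x0 -> exists2 K, 0 < K & forall z : R[i],
  x0 <= Re z -> normc (kerH a t tau z) <= expR (Re z * tau) * (K * inv1Dsqr (Im z)).
Proof.
move=> x00; have /andP[a0 a1] := a01.
have [K K0 HK] := expR_normc_powR_le (mulr_gt0 t0 cos_angle_gt0) a0 x00.
exists K => // z xz; apply: le_trans (normc_kerH_le tau _) _.
  exact: lt_le_trans xz.
by rewrite ler_wpM2l ?expR_ge0// HK.
Qed.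

Lemma normc_kerW_le tau x0 (z : R[i]) : 0 < x0 -> x0 <= Re z ->
  normc (kerW a t tau z) <= `|tau| + t * a * x0 `^ (a - 1).
Proof.
move=> x00 xz; have /andP[a0 a1] := a01.
have z0 : 0 < Re z by exact: lt_le_trans xz.
apply: le_trans (le_normcD _ _) _; rewrite normcR normcN lerD2l.
rewrite ComplexField.Normc.normcM normcR gtr0_norm ?mulr_gt0// ler_pM2l ?mulr_gt0//.
rewrite normc_powc// -[a - 1]opprB !powRN lef_pV2 ?posrE ?powR_gt0 ?normc_gt0//.
apply: ge0_ler_powR; rewrite ?nnegrE ?normc_ge0 ?subr_ge0 ?(ltW a1) ?(ltW x00)//.
by rewrite (le_trans xz)// (le_trans (ler_norm _))// Re_le_normc.
Qed.

End bounds.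
End kernel_integrand.

Section kernels.
Context {R : realType}.
Local Notation mu := (@lebesgue_measure R).
Local Notation integrableT f := (mu.-integrable setT (EFin \o f)).

Lemma integrable_normc_le (g : R -> R[i]) (M : R -> R) :
  continuous (fun y => Re (g y)) -> continuous (fun y => Im (g y)) ->
  (forall y, normc (g y) <= M y) -> integrableT M ->
  integrableT (fun y => Re (g y)) /\ integrableT (fun y => Im (g y)).
Proof.
move=> cr ci gM iM; split; apply: integrableT_continuous_le iM => // y.
  exact: le_trans (Re_le_normc _) (gM y).
exact: le_trans (Im_le_normc _) (gM y).
Qed.

Lemma integrable_inv1DsqrZ (k : R) : integrableT (fun y => k * inv1Dsqr y).
Proof. exact/integrableTZ/integrable_inv1Dsqr. Qed.

Lemma cint_bromwich (c : R) (g : R[i] -> R[i]) :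
  integrableT (fun y => Re (g (c +i* y))) -> integrableT (fun y => Im (g (c +i* y))) ->
  bromwich c g = ((2 * pi)^-1)%:C * cintegral setT (fun y => g (c +i* y)).
Proof.
move=> ir ii; rewrite /bromwich.
have -> : cintegral setT (fun y => g (c +i* y) * 'i) =
    'i * cintegral setT (fun y => g (c +i* y)).
  rewrite /cintegral; apply: complex_eqP; rewrite ReImE /=.
    under eq_Rintegral do rewrite Re_mul /= mulr0 mulr1 sub0r -mulN1r.
    by rewrite RintegralZl//; ring.
  under eq_Rintegral do rewrite Im_mul /= mulr0 mulr1 addr0.
  by ring.
rewrite mulrA; congr (_ * _); rewrite realCV invfM -mulrA mulVf ?mulr1//.
by apply/eqP => -[] /eqP; rewrite oner_eq0.
Qed.

(** The real form of [f_kernel], used for every real [tau]: positivity and the Laplace transform are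
    first obtained on the whole line, and only later is the negative half-line shown to carry no
    mass. *)
Definition pker (c a t tau : R) : R :=
  (2 * pi)^-1 * \int[mu]_y Re (kerH a t tau (c +i* y)).

Lemma continuous_kerH (a t tau c : R) : 0 < c ->
  continuous (fun y => Re (kerH a t tau (c +i* y))) /\
  continuous (fun y => Im (kerH a t tau (c +i* y))).
Proof.
move=> c0; have h y := @cder_kerH R a t tau (fun v => c +i* v) y _ c0 (cder_vline c y).
by split; [exact: cder_continuous_Re h|exact: cder_continuous_Im h].
Qed.

Lemma continuous_kerWH (a t tau c : R) : 0 < c ->
  continuous (fun y => Re (kerW a t tau (c +i* y) * kerH a t tau (c +i* y))) /\
  continuous (fun y => Im (kerW a t tau (c +i* y) * kerH a t tau (c +i* y))).
Proof.
move=> c0; have h y := @cder_kerH R a t tau (fun v => c +i* v) y _ c0 (cder_vline c y).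
have w y : {d | cder (fun v => kerW a t tau (c +i* v)) y d}.
  exact/cid/(@cder_kerW R a t tau (fun v => c +i* v) y _ c0 (cder_vline c y)).
have wh y := cderM (projT2 (w y)) (h y).
by split; [exact: cder_continuous_Re wh|exact: cder_continuous_Im wh].
Qed.

Section fixed_index.
Variable a : R.
Hypothesis a01 : 0 < a < 1.

Lemma integrable_kerH (c t tau : R) : 0 < c -> 0 < t ->
  integrableT (fun y => Re (kerH a t tau (c +i* y))) /\
  integrableT (fun y => Im (kerH a t tau (c +i* y))).
Proof.
move=> c0 t0; have [cr ci] := continuous_kerH a t tau c0.
have [K K0 HK] := normc_kerH_maj a01 t0 tau c0.
apply: (integrable_normc_le cr ci _ (integrable_inv1DsqrZ (expR (c * tau) * K))) => y.
by rewrite -mulrA HK.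
Qed.

Lemma normc_kerWH_maj (t tau x0 : R) : 0 < x0 -> 0 < t ->
  exists2 K, 0 <= K & forall z : R[i], x0 <= Re z ->
    normc (kerW a t tau z * kerH a t tau z) <= expR (Re z * tau) * (K * inv1Dsqr (Im z)).
Proof.
move=> x00 t0; have [K K0 HK] := normc_kerH_maj a01 t0 tau x00.
have /andP[a0 a1] := a01.
exists ((`|tau| + t * a * x0 `^ (a - 1)) * K).
  by rewrite mulr_ge0 ?(ltW K0)// addr_ge0// !mulr_ge0 ?powR_ge0// ltW.
move=> z xz; rewrite ComplexField.Normc.normcM -(mulrA _ K) mulrCA.
apply: ler_pM; rewrite ?normc_ge0//; last exact: HK.
exact: normc_kerW_le.
Qed.

Lemma integrable_kerWH (c t tau : R) : 0 < c -> 0 < t ->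
  integrableT (fun y => Re (kerW a t tau (c +i* y) * kerH a t tau (c +i* y))) /\
  integrableT (fun y => Im (kerW a t tau (c +i* y) * kerH a t tau (c +i* y))).
Proof.
move=> c0 t0; have [cr ci] := continuous_kerWH a t tau c0.
have [K K0 HK] := normc_kerWH_maj tau c0 t0.
apply: (integrable_normc_le cr ci _ (integrable_inv1DsqrZ (expR (c * tau) * K))) => y.
by rewrite -mulrA HK.
Qed.

(* [kerW * kerH] is the derivative of [kerH], which vanishes at infinity. *)
Lemma integral_kerWH (c t tau : R) : 0 < c -> 0 < t ->
  \int[mu]_y Re (kerW a t tau (c +i* y) * kerH a t tau (c +i* y)) = 0 /\
  \int[mu]_y Im (kerW a t tau (c +i* y) * kerH a t tau (c +i* y)) = 0.
Proof.
move=> c0 t0; have [cr ci] := continuous_kerWH a t tau c0.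
have [ir ii] := integrable_kerWH tau c0 t0.
have [K K0 HK] := normc_kerH_maj a01 t0 tau c0.
have dH y := @cder_kerH R a t tau (fun v => c +i* v) y _ c0 (cder_vline c y).
have H0 (s : R) : `|s| = 1 ->
    ccvg (fun n => kerH a t tau (c +i* (s * n%:R))) 0.
  move=> s1.
  apply: (@ccvg_normc_le _ _ _ (fun n => expR (c * tau) * K * inv1Dsqr n%:R)).
    move=> n; rewrite subr0 -mulrA; apply: le_trans (HK _ _) _ => //=.
    by rewrite /inv1Dsqr exprMn -(real_normK (num_real s)) s1 expr1n mul1r.
  by rewrite -[X in _ --> X](mulr0 (expR (c * tau) * K)); apply: cvgM;
    [exact: cvg_cst|exact: cvg_inv1Dsqr].
have [rp ip] := H0 1 (normr1 _).
have [rn in_] := H0 (-1) (normrN1 _).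
have E1 (n : nat) : 1 * n%:R = n%:R :> R := mul1r _.
have EN1 (n : nat) : -1 * n%:R = - n%:R :> R := mulN1r _.
(* Along the vertical line the derivative of [kerH] is i times [kerW * kerH]. The factor i swaps the
   components: antiderivatives of the real and imaginary parts are [Im kerH] and [- Re kerH]. *)
have dIm (y : R) : is_derive y 1 (fun y => Im (kerH a t tau (c +i* y)))
    (Re (kerW a t tau (c +i* y) * kerH a t tau (c +i* y))).
  by apply: is_derive_eq (dH y).2 _; rewrite -mulrA !ReImE /=; ring.
have dRe (y : R) : is_derive y 1 (fun y => - Re (kerH a t tau (c +i* y)))
    (Im (kerW a t tau (c +i* y) * kerH a t tau (c +i* y))).
  apply: is_derive_eq (is_derive_opp (dH y).1) _.
  by rewrite -mulrA !ReImE /=; ring.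
split.
- rewrite -[RHS](subrr 0); apply: (FTCT cr dIm ir).
  + by move: ip; under eq_fun do rewrite E1.
  + by move: in_; under eq_fun do rewrite EN1.
- rewrite -[RHS](subrr 0); apply: (FTCT ci dRe ii); rewrite -[X in _ --> X]oppr0;
    apply: cvgN.
  + by move: rp; under eq_fun do rewrite E1.
  + by move: rn; under eq_fun do rewrite EN1.
Qed.

Lemma f_kernelE (c t tau : R) : 0 < c -> 0 < t ->
  f_kernel c a t tau = (pker c a t tau)%:C.
Proof.
move=> c0 t0; have [ir ii] := integrable_kerH tau c0 t0.
have [cr ci] := continuous_kerH a t tau c0.
rewrite /f_kernel (cint_bromwich ir ii) /pker realCM; congr (_ * _).
rewrite /cintegral -[RHS]complexr0; congr (_ +i* _).
by apply: Rintegral_odd => // y; rewrite kerH_conj.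
Qed.

Lemma phi_kernelE (c t tau : R) : 0 < c -> 0 < tau ->
  phi_kernel c a t tau = (t / (a * tau) * pker c a tau t)%:C.
Proof.
move=> c0 t0; have [ir ii] := integrable_kerH t c0 t0.
have [cr ci] := continuous_kerH a tau t c0.
have [wir wii] := integrable_kerWH t c0 t0.
have [wr wi] := integral_kerWH t c0 t0.
have /andP[a0 a1] := a01.
have ta0 : a * tau != 0 by rewrite mulf_neq0// gt_eqF.
(* Solving W = t - tau a z^(a - 1) for the power gives z^(a - 1) = k + k' W, with W standing for
   [kerW a tau t z]. After multiplication by [kerH], the term with k' integrates to 0. *)
pose k := t / (a * tau); pose k' := - (a * tau)^-1.
have E (y : R) : powc (c +i* y) (a - 1) * expc ((c +i* y) * t%:C - tau%:C * powc (c +i* y) a)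
    = k%:C * kerH a tau t (c +i* y) +
      k'%:C * (kerW a tau t (c +i* y) * kerH a tau t (c +i* y)).
  rewrite /kerW /kerH /k /k'; set w := powc _ (a - 1); set e := expc _.
  have -> : (t / (a * tau))%:C = t%:C * ((a * tau)^-1)%:C by rewrite realCM.
  rewrite realCN [tau * a]mulrC.
  have : ((a * tau)^-1)%:C * (a * tau)%:C = 1 :> R[i] by rewrite -realCM mulVf.
  set u := ((a * tau)^-1)%:C; set v := (a * tau)%:C => uv.
  rewrite -[LHS]mul1r -uv; ring.
pose g z := powc z (a - 1) * expc (z * t%:C - tau%:C * powc z a).
have rE (y : R) : Re (g (c +i* y)) = k * Re (kerH a tau t (c +i* y)) +
      k' * Re (kerW a tau t (c +i* y) * kerH a tau t (c +i* y)).
  by rewrite /g E Re_add !Re_rM.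
have iE (y : R) : Im (g (c +i* y)) = k * Im (kerH a tau t (c +i* y)) +
      k' * Im (kerW a tau t (c +i* y) * kerH a tau t (c +i* y)).
  by rewrite /g E Im_add !Im_rM.
rewrite /phi_kernel (cint_bromwich (g := g)).
- rewrite /cintegral.
  under eq_Rintegral do rewrite rE.
  under [X in _ +i* X]eq_Rintegral do rewrite iE.
  rewrite !RintegralD//; try exact: integrableTZ.
  rewrite !RintegralZl// wr wi !mulr0 !addr0.
  rewrite (Rintegral_odd ci ii); last by move=> y; rewrite kerH_conj.
  by rewrite mulr0 complexr0 -realCM /pker mulrCA.
- by under eq_fun do rewrite rE; apply: integrableTD; exact: integrableTZ.
- by under eq_fun do rewrite iE; apply: integrableTD; exact: integrableTZ.
Qed.

Lemma is_derive_pker (c t tau : R) : 0 < c -> 0 < t ->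
  is_derive c 1 (fun x => \int[mu]_y Re (kerH a t tau (x +i* y))) 0.
Proof.
move=> c0 t0.
pose f (x y : R) := Re (kerH a t tau (x +i* y)).
(* The neighbourhood ]c / 2, 2 c[ stays away from 0, where the bound on [kerW] degenerates, and is
   bounded, so that exp (x tau) <= exp (2 c |tau|). Both together give one majorant [G] for all
   abscissas near [c]. *)
have c20 : 0 < c / 2 by rewrite divr_gt0.
have Ic : `]c / 2, c * 2[%classic c.
  by rewrite /= in_itv/=; apply/andP; split; lra.
have pos x : `]c / 2, c * 2[%classic x -> 0 < x.
  by rewrite /= in_itv/= => /andP[h _]; exact: lt_trans h.
have dx (x y : R) : `]c / 2, c * 2[%classic x ->
    is_derive x 1 (f ^~ y) (Re (kerW a t tau (x +i* y) * kerH a t tau (x +i* y))).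
  move=> /pos x0; have [h _] := @cder_kerH R a t tau (fun u => u +i* y) x _ x0 (cder_hline x y).
  by apply: is_derive_eq h _; rewrite mul1r.
have pE (x y : R) : `]c / 2, c * 2[%classic x ->
    partial1of2 f x y = Re (kerW a t tau (x +i* y) * kerH a t tau (x +i* y)).
  move=> /(dx x y) d; rewrite partial1of2E; exact: derive_val.
have [K K0 HK] := normc_kerWH_maj tau c20 t0.
pose G (y : R) := expR (c * 2 * `|tau|) * K * inv1Dsqr y.
have intf x : `]c / 2, c * 2[%classic x -> integrableT (f x).
  by move=> /pos x0; exact: (integrable_kerH tau x0 t0).1.
have derf x y : `]c / 2, c * 2[%classic x -> setT y -> derivable (f ^~ y) x 1.
  by move=> /(dx x y) d _; exact: ex_derive.
have G0 y : 0 <= G y by rewrite /G !mulr_ge0 ?expR_ge0// ltW// inv1Dsqr_gt0.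
have iG : integrableT G by exact: integrable_inv1DsqrZ.
have Gub x y : `]c / 2, c * 2[%classic x -> setT y -> `|partial1of2 f x y| <= G y.
  move=> Ix _; rewrite pE//; have /andP[x1 x2] : c / 2 < x < c * 2.
    by move: Ix; rewrite /= in_itv.
  apply: le_trans (Re_le_normc _) _; apply: le_trans (HK _ _) _; first exact: ltW.
  rewrite /G mulrA ler_wpM2r//= ?(ltW (inv1Dsqr_gt0 _))// ler_wpM2r// ler_expR.
  have x0 := lt_trans c20 x1.
  apply: (@le_trans _ _ (x * `|tau|)); first by rewrite ler_wpM2l ?ler_norm// ltW.
  by rewrite ler_wpM2r// ltW.
apply: DeriveDef.
  exact: (derivable_under_integral measurableT Ic intf derf G0 iG Gub).
rewrite -derive1E (differentiation_under_integral measurableT Ic intf derf G0 iG Gub).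
rewrite -[RHS](integral_kerWH tau c0 t0).1; apply: eq_Rintegral => y _.
exact: pE.
Qed.

Lemma pker_indep (c c' t tau : R) : 0 < c -> 0 < c' -> 0 < t ->
  pker c a t tau = pker c' a t tau.
Proof.
move=> c0 c'0 t0.
pose I (x : R) := \int[mu]_y Re (kerH a t tau (x +i* y)).
suff H : I c = I c'.
  exact: (congr1 (fun v => (2 * pi)^-1 * v) H).
wlog cc' : c c' c0 c'0 / c <= c'.
  by move=> H; case: (leP c c') => [|/ltW] h; [exact: H|exact/esym/H].
have pos x : c <= x -> 0 < x by exact: lt_le_trans.
have [||x _] := @MVT_segment R I (fun=> 0) c c' cc'.
- by move=> x; rewrite in_itv/= => /andP[/ltW/pos x0 _]; exact: is_derive_pker.
- apply: derivable_within_continuous => x; rewrite in_itv/= => /andP[/pos x0 _].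
  exact/ex_derive/is_derive_pker.
- rewrite mul0r => h; exact/esym/subr0_eq/h.
Qed.

End fixed_index.
End kernels.

(** * Scaling and continuity of the stable kernel *)

Section kernels_scaling.
Context {R : realType}.
Local Notation mu := (@lebesgue_measure R).
Local Notation integrableT f := (mu.-integrable setT (EFin \o f)).
Variable a : R.
Hypothesis a01 : 0 < a < 1.

(** Substitute y = l y' with l = t^(- 1 / a), chosen so that t l^a = 1. The abscissa becomes c / l,
    which [pker_indep] moves to any c'. The formula reduces the kernel to a function of one
    variable, the source of both the substitution for phi and the joint measurability for psi. *)
Lemma pker_scale (c c' t tau : R) : 0 < c -> 0 < c' -> 0 < t ->
  pker c a t tau = t `^ (- a^-1) * pker c' a 1 (tau * t `^ (- a^-1)).
Proof.
move=> c0 c'0 t0; have /andP[a0 a1] := a01.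
set l := t `^ (- a^-1); have l0 : 0 < l by exact: powR_gt0.
have cl0 : 0 < c / l by rewrite divr_gt0.
rewrite (pker_indep a01 _ c'0 cl0 ltr01) /pker mulrCA; congr (_ * _).
have [cr ci] := continuous_kerH a t tau c0.
have [ir ii] := integrable_kerH a01 tau c0 t0.
rewrite (Rintegral_scale l0 cr ir).2; apply: (congr1 ( *%R l)); apply: eq_Rintegral => y _.
have zE : c +i* (l * y) = l%:C * (c / l +i* y).
  apply: complex_eqP; rewrite !ReImE /=; last by ring.
  by field; exact: lt0r_neq0.
have tl : t%:C * (l `^ a)%:C = 1%:C :> R[i].
  rewrite -(realCM t (l `^ a)) /l -powRrM mulNr mulVf ?gt_eqF// powR_inv1 ?ltW//.
  by rewrite divff// gt_eqF.
rewrite /kerH zE powcM//.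
rewrite (mulrA t%:C) tl (realCM tau l); set z := (X in powc X).
by rewrite (mulrC tau%:C) (mulrCA z) mulrA.
Qed.

Lemma continuous_pker (c t : R) : 0 < c -> 0 < t -> continuous (pker c a t).
Proof.
move=> c0 t0 tau; apply: cvgM; first exact: cvg_cst.
pose f (s y : R) := Re (kerH a t s (c +i* y)).
have [K' K0' HK'] := normc_kerH_maj a01 t0 0 c0.
apply: (@continuity_under_integral _ _ _ mu f setT measurableT (tau - 1) (tau + 1)
  _ _ (fun y => expR (c * (tau + 1)) * K' * inv1Dsqr y)).
- by move=> s _; exact: (integrable_kerH a01 s c0 t0).1.
- apply: aeW => y _ s _.
  have h := cderZ (c +i* y) (cder_real (is_derive_id s 1)).
  exact: is_derive_continuous (cder_expc (cderD h (cder_cst _ _))).1.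
- exact: integrable_inv1DsqrZ.
- move=> s /=; rewrite in_itv/= => /andP[s1 s2]; apply: aeW => y _.
  have E : kerH a t s (c +i* y) = expc ((c +i* y) * s%:C) * kerH a t 0 (c +i* y).
    by rewrite /kerH -expcD mulr0 sub0r.
  rewrite /f E; apply: le_trans (Re_le_normc _) _; rewrite ComplexField.Normc.normcM.
  rewrite -mulrA; apply: ler_pM; rewrite ?normc_ge0//.
    by rewrite normc_expc ler_expR ReImE /= mulr0 subr0 ler_pM2l// ltW.
  by apply: le_trans (HK' _ _) _ => //=; rewrite mulr0 expR0 mul1r.
- by rewrite inE/= in_itv/=; apply/andP; split; lra.
Qed.

End kernels_scaling.

(** * Exponential and binomial series *)

Section power_series.
Context {R : realType}.

Lemma cvg0_scale (k : R) (u : nat -> R) : u n @[n --> \oo] --> (0 : R) ->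
  k * u n @[n --> \oo] --> (0 : R).
Proof. by move=> u0; rewrite -(mulr0 k); apply: cvgM => //; exact: cvg_cst. Qed.

Lemma is_derive_cvg_seq (f : R -> R) (d : R) : is_derive (0 : R) 1 f d ->
  n.+1%:R * (f n.+1%:R^-1 - f 0) @[n --> \oo] --> d.
Proof.
move=> fd; have := @ex_derive _ _ _ _ _ _ _ fd; rewrite /derivable.
move=> /cvg_ex[l hl].
have dl : d = l.
  by rewrite -(@derive_val _ _ _ _ _ _ _ fd) /derive; apply/cvg_lim.
have h0 : (forall n : nat, n.+1%:R^-1 != 0 :> R) /\ n.+1%:R^-1 @[n --> \oo] --> (0 : R).
  by split => [n|]; [rewrite invr_eq0 pnatr_eq0|exact: cvg_harmonic].
rewrite dl; move/cvgr_dnbhsP : hl => /(_ _ h0).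
by under eq_fun do rewrite invrK /GRing.scale /= mulr1 addr0.
Qed.

Lemma cder_ccvg (f : R -> R[i]) (d : R[i]) : cder f 0 d ->
  ccvg (fun n => n.+1%:R%:C * (f n.+1%:R^-1 - f 0)) d.
Proof.
move=> [fr fi]; split.
  under eq_fun do rewrite Re_rM Re_add Re_opp.
  exact: is_derive_cvg_seq fr.
under eq_fun do rewrite Im_rM Im_add Im_opp.
exact: is_derive_cvg_seq fi.
Qed.

Definition exp_partial (n : nat) (w : R[i]) : R[i] :=
  \sum_(k < n) (k`!%:R^-1)%:C * w ^+ k.

Lemma exp_partialS n w :
  exp_partial n.+1 w = exp_partial n w + (n`!%:R^-1)%:C * w ^+ n.
Proof. by rewrite /exp_partial big_ord_recr. Qed.

Lemma exp_partial0 n : exp_partial n.+1 0 = 1.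
Proof.
rewrite /exp_partial big_ord_recl expr0 mulr1 fact0 invr1 big1 ?addr0//.
by move=> i _; rewrite expr0n /= mulr0.
Qed.

Lemma cder_scale (w : R[i]) (r : R) : cder (fun u => u%:C * w) r w.
Proof.
apply: cder_eq (cderM (cder_real (is_derive_id r 1)) (cder_cst w r)) _.
by rewrite /= mulr0 addr0 rmorph1 mul1r.
Qed.

Lemma cder_exp_partial n (w : R[i]) (r : R) :
  cder (fun u => exp_partial n.+1 (u%:C * w)) r (w * exp_partial n (r%:C * w)).
Proof.
elim: n => [|n ih].
  rewrite /exp_partial big_ord0 mulr0; apply: cder_ext (cder_cst 1 r) => u.
  by rewrite big_ord1 expr0 mulr1 fact0 invr1.
apply: cder_ext (cder_eq (cderD ih (cderZ (n.+1`!%:R^-1)%:C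
    (cderX n.+1 (cder_scale w r)))) _) => [u|]; first by rewrite [RHS]exp_partialS.
rewrite exp_partialS mulrDr; congr (_ + _); rewrite /= factS natrM invfM realCM.
have : n.+1%:R^-1%:C * n.+1%:R = 1 :> R[i].
  by rewrite -(rmorph_nat (real_complex R)) -realCM mulVf ?pnatr_eq0// rmorph1.
set u := n.+1%:R^-1%:C => un; set v := (_^-1)%:C.
transitivity ((u * n.+1%:R) * (w * (v * (r%:C * w) ^+ n))); first by ring.
by rewrite un mul1r.
Qed.

Lemma normc_exp_partial_le n (w : R[i]) : normc (exp_partial n w) <= expR (normc w).
Proof.
apply: le_trans (normc_sum_le _ _) _.
apply: (@le_trans _ _ (\sum_(k < n) exp_coeff (normc w) k)).
  apply: ler_sum => k _; rewrite ComplexField.Normc.normcM normcX normcR.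
  by rewrite ger0_norm ?invr_ge0// exp_coeffE mulrC.
rewrite -(big_mkord xpredT (exp_coeff (normc w))).
apply: (@nondecreasing_cvgn_le _ (series (exp_coeff (normc w)))).
  by apply: nondecreasing_series => k _ _; rewrite exp_coeff_ge0// normc_ge0.
exact: is_cvg_series_exp_coeff.
Qed.

(** For [D] r = exp (- r w) P (r w), with P the Taylor polynomial of degree n, P' is the polynomial
    of degree n - 1, so every term of [D]' cancels except the one of degree n. The prefactor comes
    from multiplying back by exp w. *)
Lemma exp_partial_dist n (w : R[i]) :
  normc (exp_partial n.+1 w - expc w) <=
  expR (normc w) * ((normc w * expR (normc w) * (normc w ^+ n / n`!%:R)) *+ 2).
Proof.
pose D (r : R) := expc (- (r%:C * w)) * exp_partial n.+1 (r%:C * w).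
pose dD (r : R) := - (w * ((n`!%:R^-1)%:C * (r%:C * w) ^+ n)) * expc (- (r%:C * w)).
have cD (r : R) : 0 <= r <= 1 -> cder D r (dD r).
  move=> _; apply: cder_eq.
    exact: (cderM (cder_expc (cderN (cder_scale w r))) (cder_exp_partial n w r)).
  by rewrite /dD exp_partialS; ring.
have nD (r : R) : 0 <= r <= 1 ->
    normc (dD r) <= normc w * expR (normc w) * (normc w ^+ n / n`!%:R).
  move=> /andP[r0 r1]; rewrite /dD ComplexField.Normc.normcM normcN.
  rewrite !ComplexField.Normc.normcM normcX ComplexField.Normc.normcM !normcR.
  rewrite normc_expc (ger0_norm r0) ger0_norm ?invr_ge0//.
  set W := normc w; have W0 : 0 <= W by exact: normc_ge0.
  have -> : W * expR W * (W ^+ n / n`!%:R) = W * (n`!%:R^-1 * W ^+ n) * expR W by ring.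
  have rW : r * W <= W by rewrite ler_piMl.
  have rW0 : 0 <= r * W by rewrite mulr_ge0.
  apply: ler_pM; rewrite ?expR_ge0 ?mulr_ge0 ?invr_ge0 ?exprn_ge0//.
    by rewrite ler_wpM2l// ler_wpM2l ?invr_ge0// lerXn2r.
  rewrite ler_expR; apply: le_trans (ler_norm _) _.
  apply: le_trans (Re_le_normc _) _; rewrite normcN ComplexField.Normc.normcM.
  by rewrite normcR (ger0_norm r0).
have D1 : exp_partial n.+1 w - expc w = expc w * (D 1 - D 0).
  rewrite /D rmorph1 rmorph0 mul1r mul0r oppr0 expc0 exp_partial0 mulr1 mulrBr mulr1.
  by rewrite mulrA -expcD subrr expc0 mul1r.
rewrite D1 ComplexField.Normc.normcM ler_pM ?normc_ge0//.
  by rewrite normc_expc ler_expR (le_trans (ler_norm _))// Re_le_normc.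
exact: cder_normc_le cD nD.
Qed.

Lemma ccvg_exp_partial (w : R[i]) : ccvg (fun n => exp_partial n.+1 w) (expc w).
Proof.
apply: ccvg_normc_le (fun n => exp_partial_dist n w) _.
apply: cvg0_scale; under eq_fun do rewrite mulr2n; rewrite -[0]addr0.
by apply: cvgD; apply: cvg0_scale; exact: (@cvg_exp_coeff R (normc w)).
Qed.

(* [1 - binom_partial n w] is the [n]-th Taylor polynomial of [(1 - w) ^ a], and
   [binom_coef n] is the sum of its coefficients. *)
Fixpoint binom_coef (a : R) (n : nat) : R :=
  if n is n'.+1 then binom_coef a n' * ((n'.+1%:R - a) / n'.+1%:R) else 1.

Definition binom_partial (a : R) (n : nat) (w : R[i]) : R[i] :=
  \sum_(k < n) (a * binom_coef a k / k.+1%:R)%:C * w ^+ k.+1.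

Definition binom_partial' (a : R) (n : nat) (w : R[i]) : R[i] :=
  \sum_(k < n) (a * binom_coef a k)%:C * w ^+ k.

Section binomial_series.
Variable a : R.
Hypothesis a01 : 0 < a < 1.

(** A product of factors 1 - a / k, each in [0, 1] because 0 < a < 1. The lower bound makes the
    coefficients of [binom_partial] nonnegative; it also keeps their sum at most 1. *)
Lemma binom_coef01 n : 0 <= binom_coef a n <= 1.
Proof.
have /andP[a0 a1] := a01.
elim: n => [|n /andP[b0 b1]] /=; first by rewrite ler01 lexx.
have n0 : 0 < n.+1%:R :> R by rewrite ltr0n.
have n1 : 1 <= n.+1%:R :> R by rewrite ler1n.
have na : a <= n.+1%:R by exact: le_trans (ltW a1) n1.
rewrite mulr_ge0 ?divr_ge0 ?subr_ge0//= mulr_ile1 ?divr_ge0 ?subr_ge0//.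
by rewrite ler_pdivrMr// mul1r gerBl ltW.
Qed.

(** Telescopes: the k-th summand is [binom_coef a k - binom_coef a k.+1]. *)
Lemma sum_binom_coef n :
  \sum_(k < n) (a * binom_coef a k / k.+1%:R) = 1 - binom_coef a n.
Proof.
elim: n => [|n ih]; first by rewrite big_ord0 subrr.
rewrite big_ord_recr /= ih.
by field; rewrite addrC natr1 pnatr_eq0.
Qed.

(** The coefficients are nonnegative with sum at most 1. Consequently 1 - P, for P the partial sum,
    has nonnegative real part, and exp (- l (1 - P)) is bounded by 1 uniformly in [n]. *)
Lemma binom_partial_le1 n (w : R[i]) : normc w <= 1 -> normc (binom_partial a n w) <= 1.
Proof.
move=> w1; have /andP[a0 a1] := a01.
apply: le_trans (normc_sum_le _ _) _.
apply: (@le_trans _ _ (\sum_(k < n) (a * binom_coef a k / k.+1%:R))).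
  apply: ler_sum => k _; have /andP[b0 b1] := binom_coef01 k.
  have c0 : 0 <= a * binom_coef a k / k.+1%:R.
    by rewrite divr_ge0// mulr_ge0// ltW.
  rewrite ComplexField.Normc.normcM normcR normcX ger0_norm//.
  by rewrite ler_piMr// exprn_ile1// normc_ge0.
by rewrite sum_binom_coef gerBl; have /andP[] := binom_coef01 n.
Qed.

Lemma cder_binom_partial n (w : R[i]) (r : R) :
  cder (fun u => binom_partial a n (u%:C * w)) r (w * binom_partial' a n (r%:C * w)).
Proof.
apply: cder_eq.
  apply: cder_sum => k; exact: cderZ (cderX k.+1 (cder_scale w r)).
rewrite /binom_partial' mulr_sumr; apply: eq_bigr => k _ /=.
have : k.+1%:R^-1%:C * k.+1%:R = 1 :> R[i].
  by rewrite -(rmorph_nat (real_complex R)) -realCM mulVf ?pnatr_eq0// rmorph1.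
rewrite realCM; set u := k.+1%:R^-1%:C => uk; set v := (_ * _)%:C.
transitivity ((u * k.+1%:R) * (w * (v * (r%:C * w) ^+ k))); first by ring.
by rewrite uk mul1r.
Qed.

(** The function p = (1 - w)^a solves a p + (1 - w) p' = 0. Its Taylor polynomial, truncated, misses
    this equation by a single monomial. *)
Lemma binom_partial_ode n (w : R[i]) :
  a%:C * (1 - binom_partial a n w) - (1 - w) * binom_partial' a n w =
  (a * binom_coef a n)%:C * w ^+ n.
Proof.
elim: n => [|n ih].
  by rewrite /binom_partial /binom_partial' !big_ord0 /= subr0 mulr0 subr0 expr0 !mulr1.
rewrite /binom_partial /binom_partial' !big_ord_recr -/(binom_partial a n w).
rewrite -/(binom_partial' a n w) [in RHS]/=.
have -> : a * (binom_coef a n * ((n.+1%:R - a) / n.+1%:R)) =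
    a * binom_coef a n - a * (a * binom_coef a n / n.+1%:R).
  by field; rewrite addrC natr1 pnatr_eq0.
rewrite realCD realCN (realCM a (_ / _)).
set b := (a * binom_coef a n)%:C in ih *; set c := (_ / _)%:C => /=.
transitivity ((a%:C * (1 - binom_partial a n w) - (1 - w) * binom_partial' a n w)
  - (1 - w) * (b * w ^+ n) - a%:C * c * w ^+ n.+1); first by ring.
by rewrite ih exprS; ring.
Qed.

(* The derivative in [r] of the [n]-th Taylor polynomial at [r w], divided by
   [(1 - r w) ^ a], is [O(|w| ^ n)] by [binom_partial_ode]. *)
Lemma ccvg_binom_partial (w : R[i]) : normc w < 1 ->
  ccvg (fun n => 1 - binom_partial a n w) (powc (1 - w) a).
Proof.
move=> w1; have /andP[a0 a1] := a01; have w0 := normc_ge0 w.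
have pos (r : R) : 0 <= r <= 1 -> 1 - normc w <= Re (1 - r%:C * w).
  move=> /andP[r0 r1]; rewrite !ReImE /= mul0r subr0 lerD2l lerN2.
  apply: (@le_trans _ _ (r * normc w)); last by rewrite ler_piMl.
  by rewrite ler_wpM2l// (le_trans (ler_norm _))// Re_le_normc.
have eta0 : 0 < 1 - normc w by rewrite subr_gt0.
pose D n (r : R) := (1 - binom_partial a n (r%:C * w)) * powc (1 - r%:C * w) (- a).
pose dD n (r : R) := w * powc (1 - r%:C * w) (- a - 1) *
  ((a * binom_coef a n)%:C * (r%:C * w) ^+ n).
have cD n (r : R) : 0 <= r <= 1 -> cder (D n) r (dD n r).
  move=> r01; have p0 : 0 < Re (1 - r%:C * w) by exact: lt_le_trans (pos r r01).
  have c1 : cder (fun u => 1 - u%:C * w) r (- w).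
    by apply: cder_eq (cderD (cder_cst 1 r) (cderN (cder_scale w r))) _; rewrite add0r.
  apply: cder_eq.
    exact: (cderM (cderD (cder_cst 1 r) (cderN (cder_binom_partial n w r)))
      (cder_powc (- a) p0 c1)).
  rewrite /dD -binom_partial_ode powcB1// realCN.
  by field; exact: Re_gt0_neq0.
pose C := normc w * (1 - normc w) `^ (- a - 1) * a.
have nD n (r : R) : 0 <= r <= 1 -> normc (dD n r) <= C * normc w ^+ n.
  move=> r01; have p0 : 0 < Re (1 - r%:C * w) by exact: lt_le_trans (pos r r01).
  have /andP[r0 r1] := r01; have /andP[b0 b1] := binom_coef01 n.
  rewrite /dD !ComplexField.Normc.normcM normcX ComplexField.Normc.normcM !normcR.
  rewrite (ger0_norm r0) ger0_norm ?mulr_ge0 ?(ltW a0)// /C mulrA.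
  apply: ler_pM; rewrite ?mulr_ge0 ?normc_ge0 ?exprn_ge0 ?(ltW a0) ?mulr_ge0//.
    apply: ler_pM; rewrite ?mulr_ge0 ?normc_ge0 ?(ltW a0)//; last by rewrite ler_piMr// ltW.
    rewrite ler_wpM2l// normc_powc// -opprD !powRN lef_pV2 ?posrE ?powR_gt0 ?normc_gt0//.
    apply: ge0_ler_powR; rewrite ?nnegrE ?normc_ge0 ?(addr_ge0 (ltW a0) ler01) ?(ltW eta0)//.
    by rewrite (le_trans (pos r r01))// (le_trans (ler_norm _))// Re_le_normc.
  by rewrite lerXn2r ?nnegrE ?mulr_ge0// ler_piMl.
have p1 : 0 < Re (1 - w).
  by have := pos 1; rewrite rmorph1 mul1r ler01 lexx => /(_ isT); exact: lt_le_trans.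
have D1 n : 1 - binom_partial a n w - powc (1 - w) a = powc (1 - w) a * (D n 1 - D n 0).
  rewrite /D rmorph1 rmorph0 mul1r mul0r subr0 -(rmorph1 (real_complex R)) powcR//.
  have -> : binom_partial a n 0 = 0.
    by rewrite /binom_partial big1// => k _; rewrite expr0n mulr0.
  rewrite powR1 rmorph1 subr0 mulr1 mulrBr mulr1 mulrCA powcN divff ?mulr1//.
  exact: powc_neq0.
apply: (@ccvg_normc_le _ _ _ (fun n => normc (powc (1 - w) a) * ((C *+ 2) * normc w ^+ n))).
  move=> n; rewrite D1 ComplexField.Normc.normcM ler_wpM2l ?normc_ge0//.
  by rewrite mulrnAl; exact: cder_normc_le (cD n) (nD n).
have h : normc w ^+ n @[n --> \oo] --> (0 : R) by apply: cvg_expr; rewrite ger0_norm.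
by apply: cvg0_scale; exact: cvg0_scale.
Qed.

End binomial_series.
End power_series.

(** * Positivity *)

Section positive_multipliers.
Context {R : realType}.
Local Notation mu := (@lebesgue_measure R).
Local Notation integrableT f := (mu.-integrable setT (EFin \o f)).
Implicit Types (g m : R -> R[i]) (K : R).

Definition cis (x : R) : R[i] := expc (0 +i* x).

Lemma cisD x y : cis (x + y) = cis x * cis y.
Proof.
by rewrite /cis -expcD; congr expc; apply: complex_eqP; rewrite ReImE /= ?addr0.
Qed.

Lemma normc_cis x : normc (cis x) = 1.
Proof. by rewrite normc_expc /= expR0. Qed.

Definition cmeasurable g : Prop :=
  measurable_fun setT (fun y => Re (g y)) /\ measurable_fun setT (fun y => Im (g y)).

Lemma cmeasurableM g m : cmeasurable g -> cmeasurable m ->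
  cmeasurable (fun y => g y * m y).
Proof.
move=> [gr gi] [mr mi]; split.
  by under eq_fun do rewrite Re_mul; apply: measurable_funB; exact: measurable_funM.
by under eq_fun do rewrite Im_mul; apply: measurable_funD; exact: measurable_funM.
Qed.

Lemma cmeasurableD g m : cmeasurable g -> cmeasurable m ->
  cmeasurable (fun y => g y + m y).
Proof.
move=> [gr gi] [mr mi]; split.
  by under eq_fun do rewrite Re_add; exact: measurable_funD.
by under eq_fun do rewrite Im_add; exact: measurable_funD.
Qed.

Lemma cmeasurable_cst (z : R[i]) : cmeasurable (fun=> z).
Proof. by split; exact: measurable_cst. Qed.

Lemma cmeasurable_cder g (dg : R -> R[i]) : (forall y, cder g y (dg y)) -> cmeasurable g.
Proof.
move=> h; split; apply: continuous_measurable_fun.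
  exact: cder_continuous_Re h.
exact: cder_continuous_Im h.
Qed.

Lemma cmeasurable_cis (k : R) : cmeasurable (fun y => cis (y * k)).
Proof.
apply: (@cmeasurable_cder _ (fun y => 'i * k%:C * cis (y * k))) => y; apply: cder_expc.
split => /=; first by apply: is_derive_eq (is_derive_cst (0 : R) y 1) _; ring.
apply: is_derive_eq (is_derive_mul (is_derive_id y 1) (is_derive_cst k y 1)) _.
by rewrite /=; ring.
Qed.

Lemma cmeasurable_lim (m : nat -> R -> R[i]) (l : R -> R[i]) :
  (forall n, cmeasurable (m n)) -> (forall y, ccvg (m ^~ y) (l y)) -> cmeasurable l.
Proof.
move=> mm ml; split.
  apply: (measurable_fun_cvg (h := fun n y => Re (m n y))) => [n|y _].
    exact: (mm n).1.
  exact: (ml y).1.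
apply: (measurable_fun_cvg (h := fun n y => Im (m n y))) => [n|y _].
  exact: (mm n).2.
exact: (ml y).2.
Qed.

Lemma ccvg_normc_bound (u : nat -> R[i]) (l : R[i]) K :
  ccvg u l -> (forall n, normc (u n) <= K) -> normc l <= K.
Proof.
move=> [ur ui] uK.
have K0 : 0 <= K by apply: le_trans (uK 0%N); exact: normc_ge0.
rewrite -(@ler_sqr _ (normc l)) ?nnegrE ?normc_ge0// normc_sqr.
have h : Re (u n) ^+ 2 + Im (u n) ^+ 2 @[n --> \oo] --> Re l ^+ 2 + Im l ^+ 2.
  by apply: cvgD; under eq_fun do rewrite expr2; rewrite expr2; exact: cvgM.
rewrite -(cvg_lim (@Rhausdorff R) h); apply: limr_le; first exact: cvgP h.
by apply: nearW => n; rewrite -normc_sqr ler_sqr ?nnegrE ?normc_ge0.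
Qed.

(** An explicit majorant [M] is carried along because it survives multiplication by bounded
    functions and serves directly for dominated convergence. *)
Definition fourier_pos g : Prop :=
  [/\ cmeasurable g, exists2 M, integrableT M & forall y, normc (g y) <= M y &
      forall tau, 0 <= \int[mu]_y Re (g y * cis (y * tau))].

(** In the spirit of Bochner's theorem: Fourier transforms of finite positive measures act in this
    way, since they convolve the transform of [g] with a positive measure. Defining the class by its
    action gives products, sums and limits without naming the measure. The bound [K] provides the
    domination when limits are taken. *)
Definition pos_multiplier K m : Prop :=
  [/\ cmeasurable m, forall y, normc (m y) <= K &
      forall g, fourier_pos g ->
        forall tau, 0 <= \int[mu]_y Re (m y * g y * cis (y * tau))].

Lemma fourier_integrable g (M : R -> R) tau : cmeasurable g -> integrableT M ->
  (forall y, normc (g y) <= M y) -> integrableT (fun y => Re (g y * cis (y * tau))).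
Proof.
move=> mg iM gM; apply: integrableT_le iM => [|y].
  exact: (cmeasurableM mg (cmeasurable_cis tau)).1.
apply: le_trans (Re_le_normc _) _.
by rewrite ComplexField.Normc.normcM normc_cis mulr1.
Qed.

Lemma fourier_pos_lim (g : nat -> R -> R[i]) (l : R -> R[i]) (M : R -> R) :
  integrableT M -> (forall n, fourier_pos (g n)) -> (forall n y, normc (g n y) <= M y) ->
  (forall y, ccvg (g ^~ y) (l y)) -> fourier_pos l.
Proof.
move=> iM gp gM gl; split.
- by apply: (cmeasurable_lim _ gl) => n; have [] := gp n.
- by exists M => // y; apply: ccvg_normc_bound (gl y) _.
- move=> tau.
  have [||||_ h] := @dominated_cvgT R (fun n y => Re (g n y * cis (y * tau)))
    (fun y => Re (l y * cis (y * tau))) M.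
  + by move=> n; have [mg _ _] := gp n; exact: (cmeasurableM mg (cmeasurable_cis tau)).1.
  + by move=> y; exact: (ccvgM (gl y) (ccvg_cst _)).1.
  + exact: iM.
  + move=> n y; apply: le_trans (Re_le_normc _) _.
    by rewrite ComplexField.Normc.normcM normc_cis mulr1.
  rewrite -(cvg_lim (@Rhausdorff R) h); apply: limr_ge; first exact: cvgP h.
  by apply: nearW => n; have [_ _] := gp n.
Qed.

Lemma fourier_posM K m g : pos_multiplier K m -> fourier_pos g ->
  fourier_pos (fun y => m y * g y).
Proof.
move=> [mm mK mp] gp; have [mg [M iM gM] _] := gp; split.
- exact: cmeasurableM.
- exists (fun y => K * M y); first exact: integrableTZ.
  by move=> y; rewrite ComplexField.Normc.normcM ler_pM ?normc_ge0.
- exact: mp.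
Qed.

Lemma pos_multiplierM K K' m m' : pos_multiplier K m -> pos_multiplier K' m' ->
  pos_multiplier (K * K') (fun y => m y * m' y).
Proof.
move=> pm pm'; have [mm mK _] := pm; have [mm' mK' _] := pm'; split.
- exact: cmeasurableM.
- by move=> y; rewrite ComplexField.Normc.normcM ler_pM ?normc_ge0.
- move=> g gp tau; have [_ _] := fourier_posM pm (fourier_posM pm' gp).
  by move=> /(_ tau); under eq_Rintegral do rewrite mulrA.
Qed.

Lemma pos_multiplierD K K' m m' : pos_multiplier K m -> pos_multiplier K' m' ->
  pos_multiplier (K + K') (fun y => m y + m' y).
Proof.
move=> pm pm'; have [mm mK mp] := pm; have [mm' mK' mp'] := pm'; split.
- exact: cmeasurableD.
- by move=> y; apply: le_trans (le_normcD _ _) _; rewrite lerD.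
- move=> g gp tau.
  have [mg [M iM gM] _] := fourier_posM pm gp.
  have [mg' [M' iM' gM'] _] := fourier_posM pm' gp.
  under eq_Rintegral do rewrite mulrDl mulrDl Re_add.
  rewrite RintegralD ?addr_ge0//; [exact: mp|exact: mp'| |].
    exact: fourier_integrable mg iM gM.
  exact: fourier_integrable mg' iM' gM'.
Qed.

Lemma pos_multiplier_cst (k : R) : 0 <= k -> pos_multiplier k (fun=> k%:C).
Proof.
move=> k0; split; [exact: cmeasurable_cst|by move=> _; rewrite normcR ger0_norm|].
move=> g [mg [M iM gM] gp] tau.
under eq_Rintegral do rewrite -mulrA Re_rM.
rewrite RintegralZl ?mulr_ge0//; exact: fourier_integrable mg iM gM.
Qed.

(** Multiplication by a character translates the Fourier transform. *)
Lemma pos_multiplier_cis (u : R) : pos_multiplier 1 (fun y => cis (y * u)).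
Proof.
split; [exact: cmeasurable_cis|by move=> y; rewrite normc_cis|].
move=> g [_ _ gp] tau.
by under eq_Rintegral do rewrite mulrAC mulrC -cisD -mulrDr.
Qed.

Lemma pos_multiplierX K m n : pos_multiplier K m ->
  pos_multiplier (K ^+ n) (fun y => m y ^+ n).
Proof.
move=> pm; elim: n => [|n ih]; first exact: (@pos_multiplier_cst 1).
by rewrite exprS; under eq_fun do rewrite exprS; exact: pos_multiplierM.
Qed.

Lemma pos_multiplierZ K m k : 0 <= k -> pos_multiplier K m ->
  pos_multiplier (k * K) (fun y => k%:C * m y).
Proof. by move=> k0 pm; apply: pos_multiplierM => //; exact: pos_multiplier_cst. Qed.

Lemma pos_multiplier_poly n (c : nat -> R) (e : nat -> nat) K m :
  (forall k, 0 <= c k) -> pos_multiplier K m ->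
  exists K', pos_multiplier K' (fun y => \sum_(k < n) (c k)%:C * m y ^+ e k).
Proof.
move=> c0 pm; elim: n => [|n [K' ih]].
  exists 0; under eq_fun do rewrite big_ord0.
  exact: (@pos_multiplier_cst 0).
exists (K' + c n * K ^+ e n); under eq_fun do rewrite big_ord_recr.
by apply: pos_multiplierD => //; apply: pos_multiplierZ => //; exact: pos_multiplierX.
Qed.

(** Algebraic operations give crude bounds that may grow with the degree. They are exchanged here
    for a true uniform bound before passing to the limit. *)
Lemma pos_multiplier_le K K' m : (forall y, normc (m y) <= K') ->
  pos_multiplier K m -> pos_multiplier K' m.
Proof. by move=> mK' [mm _ mp]. Qed.

Lemma pos_multiplier_lim K (m : nat -> R -> R[i]) (l : R -> R[i]) :
  (forall n, pos_multiplier K (m n)) -> (forall y, ccvg (m ^~ y) (l y)) ->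
  pos_multiplier K l.
Proof.
move=> mp ml; split.
- by apply: (cmeasurable_lim _ ml) => n; have [] := mp n.
- by move=> y; apply: ccvg_normc_bound (ml y) _ => n; have [] := mp n.
- move=> g gp tau; have [mg [M iM gM] _] := gp.
  have [] // := @fourier_pos_lim (fun n y => m n y * g y) (fun y => l y * g y)
    (fun y => K * M y).
  + exact: integrableTZ.
  + by move=> n; exact: fourier_posM (mp n) gp.
  + move=> n y; rewrite ComplexField.Normc.normcM ler_pM ?normc_ge0//.
    by have [] := mp n.
  + by move=> y; exact: ccvgM (ml y) (ccvg_cst _).
Qed.

Lemma pos_multiplier_exp K m : pos_multiplier K m ->
  pos_multiplier (expR K) (fun y => expc (m y)).
Proof.
move=> pm; apply: (pos_multiplier_lim (m := fun n y => exp_partial n.+1 (m y))) => [n|y].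
  have [K' pK'] := @pos_multiplier_poly n.+1 (fun k => k`!%:R^-1) id K m
    (fun k => ltac:(by rewrite invr_ge0)) pm.
  apply: pos_multiplier_le pK' => y; apply: le_trans (normc_exp_partial_le _ _) _.
  by rewrite ler_expR; have [_] := pm.
exact: ccvg_exp_partial.
Qed.

End positive_multipliers.

(** * The function exp (- t z^a) is a positive multiplier on vertical lines *)

Section stable_positivity.
Context {R : realType}.
Local Notation mu := (@lebesgue_measure R).
Local Notation integrableT f := (mu.-integrable setT (EFin \o f)).
Variables (a c : R).
Hypotheses (a01 : 0 < a < 1) (c0 : 0 < c).

(** On the line, exp (- d z) is a character times the constant exp (- d c), which is the transform
    of a point mass. *)
Lemma pos_multiplier_expc_vline (d : R) : 0 < d ->
  pos_multiplier (expR (- (d * c))) (fun y => expc (- (d%:C * (c +i* y)))).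
Proof.
move=> d0.
have E (y : R) : expc (- (d%:C * (c +i* y))) = (expR (- (d * c)))%:C * cis (y * (- d)).
  rewrite -expcR /cis -expcD; congr expc.
  by apply: complex_eqP; rewrite !ReImE /=; ring.
under eq_fun do rewrite E.
by rewrite -[X in pos_multiplier X]mulr1; apply: pos_multiplierZ;
  [exact: expR_ge0|exact: pos_multiplier_cis].
Qed.

(** Compound Poisson form: exp (- l (1 - P)) = exp (- l) exp (l P), where P is a partial sum with
    nonnegative coefficients in a positive multiplier. The minus sign in the exponent is thus
    absorbed by a positive constant. *)
Lemma pos_multiplier_binomial (d l : R) : 0 < d -> 0 < l ->
  pos_multiplier 1 (fun y => expc (- (l%:C * powc (1 - expc (- (d%:C * (c +i* y)))) a))).
Proof.
move=> d0 l0; have /andP[a0 a1] := a01.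
have pw := pos_multiplier_expc_vline d0.
have w1 (y : R) : normc (expc (- (d%:C * (c +i* y)))) < 1.
  have [_ h _] := pw; apply: le_lt_trans (h y) _.
  by rewrite expR_lt1 oppr_lt0 mulr_gt0.
apply: (pos_multiplier_lim (m := fun n y =>
    expc (- (l%:C * (1 - binom_partial a n (expc (- (d%:C * (c +i* y))))))))) => [n|y].
  have [K' pK'] := @pos_multiplier_poly R n (fun k => a * binom_coef a k / k.+1%:R) S _ _
    (fun k => divr_ge0 (mulr_ge0 (ltW a0) (andP (binom_coef01 a01 k)).1) (ler0n _ _)) pw.
  have E (y : R) : expc (- (l%:C * (1 - binom_partial a n (expc (- (d%:C * (c +i* y))))))) =
      (expR (- l))%:C * expc (l%:C * binom_partial a n (expc (- (d%:C * (c +i* y))))).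
    by rewrite -expcR -expcD realCN; congr expc; ring.
  under eq_fun do rewrite E.
  apply: pos_multiplier_le; last first.
    apply: pos_multiplierZ; first exact: expR_ge0.
    by apply: pos_multiplier_exp; apply: pos_multiplierZ; [exact: ltW|exact: pK'].
  move=> y; rewrite ComplexField.Normc.normcM normcR ger0_norm ?expR_ge0// normc_expc.
  rewrite -expRD -expR0 ler_expR addrC subr_le0 Re_rM ler_piMr ?(ltW l0)//.
  apply: le_trans (ler_norm _) _; apply: le_trans (Re_le_normc _) _.
  by apply: binom_partial_le1 => //; exact: ltW.
apply: ccvg_expc; apply: ccvgN; apply: ccvgM; first exact: ccvg_cst.
exact: ccvg_binom_partial.
Qed.

Lemma pos_multiplier_stable (t : R) : 0 < t ->
  pos_multiplier 1 (fun y => kerH a t 0 (c +i* y)).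
Proof.
move=> t0; have /andP[a0 a1] := a01.
pose d (n : nat) : R := n.+1%:R^-1.
have d0 n : 0 < d n by rewrite invr_gt0 ltr0n.
apply: (pos_multiplier_lim (m := fun n y => expc (- ((t * (d n)^-1 `^ a)%:C *
    powc (1 - expc (- ((d n)%:C * (c +i* y)))) a)))) => [n|y].
  by apply: pos_multiplier_binomial => //; rewrite mulr_gt0 ?powR_gt0 ?invr_gt0.
have pos (n : nat) : 0 < Re (1 - expc (- ((d n)%:C * (c +i* y)))).
  rewrite Re_add Re_opp subr_gt0; apply: le_lt_trans (ler_norm _) _.
  apply: le_lt_trans (Re_le_normc _) _; rewrite normc_expc expR_lt1 Re_opp Re_rM.
  by rewrite oppr_lt0 mulr_gt0.
rewrite /kerH mulr0 sub0r; apply: ccvg_expc; apply: ccvgN.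
(* With l = t d^(- a), homogeneity of the power brings 1 / d inside, and the base becomes the
   difference quotient (1 - exp (- d z)) / d. *)
have E n : (t * (d n)^-1 `^ a)%:C * powc (1 - expc (- ((d n)%:C * (c +i* y)))) a =
    t%:C * powc ((d n)^-1%:C * (1 - expc (- ((d n)%:C * (c +i* y))))) a.
  by rewrite realCM -mulrA -powcM ?invr_gt0.
have -> : (fun n => (t * (d n)^-1 `^ a)%:C *
    powc (1 - expc (- ((d n)%:C * (c +i* y)))) a) =
    (fun n => t%:C * powc ((d n)^-1%:C * (1 - expc (- ((d n)%:C * (c +i* y))))) a).
  by apply/funext => n; exact: E.
apply: ccvgM; first exact: ccvg_cst.
apply: ccvg_powc => //.
  by move=> n; rewrite Re_rM mulr_gt0// invr_gt0.
(* The difference quotient tends to the derivative at 0 of u |-> - exp (- u z), which is z. *)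
have h : cder (fun u : R => - expc (- (u%:C * (c +i* y)))) 0 (c +i* y).
  apply: cder_eq (cderN (cder_expc (cderN (cder_scale (c +i* y) 0)))) _.
  by rewrite rmorph0 mul0r oppr0 expc0 mulr1 opprK.
have := cder_ccvg h; rewrite rmorph0 mul0r oppr0 expc0.
congr (ccvg _ _); apply/funext => n; rewrite /d invrK opprK addrC.
by [].
Qed.

End stable_positivity.

(** * The Abel factor and its Fourier transform *)

Section stable_density.
Context {R : realType}.
Local Notation mu := (@lebesgue_measure R).
Local Notation integrableT f := (mu.-integrable setT (EFin \o f)).

(** The Abel summation factor, whose Fourier transform is the Poisson kernel. It is used in [y] as a
    function with nonnegative transform, and in [tau] as a convergence factor. *)
Definition abel (e y : R) : R := expR (- (e * `|y|)).

Lemma continuous_expRM (e : R) : continuous (fun x : R => expR (- (e * x))).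
Proof.
move=> x; apply: continuous_comp; last exact: continuous_expR.
by apply: continuousN; exact: mulrl_continuous.
Qed.

Lemma continuous_abel (e : R) : continuous (abel e).
Proof.
move=> x; apply: (@continuous_comp R R R Num.norm (fun x : R => expR (- (e * x)))).
  exact: norm_continuous.
exact: continuous_expRM.
Qed.

Lemma is_derive_expRM (e x : R) :
  is_derive x 1 (fun x : R => expR (- (e * x))) (- e * expR (- (e * x))).
Proof.
have d := is_derive_opp (is_derive_mul (is_derive_cst e x 1) (is_derive_id x 1)).
by apply: is_derive_eq (is_derive_comp (is_derive_expR _) d) _; rewrite /=; ring.
Qed.

Lemma cvg_expRM0 (e : R) (B : R -> R) (b : R) : 0 < e -> (forall x, `|B x| <= b) ->
  expR (- (e * x)) * B x @[x --> +oo] --> (0 : R).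
Proof.
move=> e0 Bb.
have h : b * expR (- (e * x)) @[x --> +oo] --> (0 : R).
  rewrite -(mulr0 b); apply: cvgM; first exact: cvg_cst.
  apply: (cvg_comp _ _ _ (@cvgr_expR R)).
  exact/gt0_cvgMry.
apply: norm_cvg0; apply: squeeze_cvgr h; last exact: (cvg_cst 0).
near=> x; rewrite normr_ge0/= normrM ger0_norm ?expR_ge0//.
by rewrite mulrC ler_wpM2r// expR_ge0.
Unshelve. all: by end_near. Qed.

Lemma integral_abel (e : R) : 0 < e -> (\int[mu]_y (abel e y)%:E = (2 / e)%:E)%E.
Proof.
move=> e0.
have dF (x : R) : is_derive x 1 (fun x => expR (- (e * x)) * - e^-1) (expR (- (e * x))).
  apply: is_derive_eq (is_derive_mul (is_derive_expRM e x) (is_derive_cst (- e^-1) x 1)) _.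
  by rewrite /=; field; exact: lt0r_neq0.
have Fl := @cvg_expRM0 e (fun=> - e^-1) `|- e^-1| e0 (fun=> lexx _).
rewrite (ge0_even_FTC (@continuous_expRM e) _ dF Fl).
  by rewrite mulr0 oppr0 expR0 mul1r sub0r opprK.
by move=> x; exact: expR_ge0.
Qed.

Lemma integrable_abel (e : R) : 0 < e -> integrableT (abel e).
Proof.
move=> e0; apply: integrableT_ge0_eq (integral_abel e0).
  exact: continuous_measurable_fun (@continuous_abel e).
by move=> y; exact: expR_ge0.
Qed.

(** Adding 1 to the cosine makes the integrand nonnegative, as [ge0_even_FTC] demands. The added 2 /
    e is subtracted again in [Rintegral_abel_cos]. *)
Lemma integral_abel_cosD (e s : R) : 0 < e ->
  (\int[mu]_y (abel e y * (1 + cos (y * s)))%:E =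
   (2 / e + 2 * e / (e ^+ 2 + s ^+ 2))%:E)%E.
Proof.
move=> e0; set D := e ^+ 2 + s ^+ 2.
have D0 : 0 < D by rewrite ltr_wpDr ?sqr_ge0// exprn_gt0.
(* exp (- e x) B (x) is the antiderivative: - 1 / e comes from the summand 1, the rest from the real
   part of exp ((- e + i s) x) / (- e + i s). *)
pose B (x : R) := - e^-1 + (s * sin (x * s) - e * cos (x * s)) / D.
have dxs (x : R) : is_derive x 1 (fun x => x * s) s.
  apply: is_derive_eq (is_derive_mul (is_derive_id x 1) (is_derive_cst s x 1)) _.
  by rewrite /=; ring.
have dsin (x : R) := is_derive_comp (g := fun x => x * s) (is_derive_sin (x * s)) (dxs x).
have dcos (x : R) := is_derive_comp (g := fun x => x * s) (is_derive_cos (x * s)) (dxs x).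
have dF (x : R) : is_derive x 1 (fun x => expR (- (e * x)) * B x)
    (expR (- (e * x)) * (1 + cos (x * s))).
  have dB : is_derive x 1 B (s * (cos (x * s) * s) / D - e * (- sin (x * s) * s) / D).
    have d1 := is_derive_mul (is_derive_cst s x 1) (dsin x).
    have d2 := is_derive_opp (is_derive_mul (is_derive_cst e x 1) (dcos x)).
    have d3 := is_derive_mul (is_derive_add d1 d2) (is_derive_cst D^-1 x 1).
    apply: is_derive_eq (is_derive_add (is_derive_cst (- e^-1) x 1) d3) _.
    by rewrite /=; ring.
  apply: is_derive_eq (is_derive_mul (is_derive_expRM e x) dB) _.
  rewrite /B /D; field; apply/andP; split; [exact: lt0r_neq0|exact: lt0r_neq0].
have Bb (x : R) : `|B x| <= e^-1 + (`|s| + e) / D.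
  rewrite /B; apply: le_trans (ler_normD _ _) _; apply: lerD.
    by rewrite normrN ger0_norm// invr_ge0 ltW.
  rewrite normrM [`|D^-1|]ger0_norm ?invr_ge0 ?(ltW D0)// ler_pM2r ?invr_gt0//.
  apply: le_trans (ler_normB _ _) _; rewrite !normrM (gtr0_norm e0); apply: lerD.
    by rewrite ler_piMr// ler_norml sin_geN1 sin_le1.
  by rewrite ler_piMr ?(ltW e0)// ler_norml cos_geN1 cos_le1.
have cf : continuous (fun x : R => expR (- (e * x)) * (1 + cos (x * s))).
  move=> x; apply: cvgM; first exact: continuous_expRM.
  by apply: cvgD; [exact: cvg_cst|exact: is_derive_continuous (dcos x)].
transitivity (\int[mu]_y ((fun x => expR (- (e * x)) * (1 + cos (x * s))) `|y|)%:E)%E.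
  apply: eq_integral => y _; congr (_%:E); rewrite /abel; congr (_ * (1 + _)).
  by case: (ger0P y) => // _; rewrite mulNr cosN.
rewrite (ge0_even_FTC cf _ dF (cvg_expRM0 e0 Bb)).
  congr (_%:E); rewrite /B mulr0 oppr0 expR0 mul0r cos0 sin0 /D.
  by field; rewrite !lt0r_neq0.
move=> x; rewrite mulr_ge0 ?expR_ge0// -lerBlDl sub0r; exact: cos_geN1.
Qed.

Lemma integrable_abel_le (e : R) (B : R -> R) (b : R) : 0 < e -> continuous B ->
  (forall x, `|B x| <= b) -> integrableT (fun y => abel e y * B y).
Proof.
move=> e0 cB Bb; apply: integrableT_continuous_le (integrableTZ b (integrable_abel e0)).
  by move=> x; apply: cvgM; [exact: continuous_abel|exact: cB].
move=> x; rewrite normrM ger0_norm ?expR_ge0// mulrC ler_wpM2r//.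
exact: expR_ge0.
Qed.

Lemma continuous_cosM (s : R) : continuous (fun y : R => cos (y * s)).
Proof.
by move=> y; apply: continuous_comp; [exact: mulrr_continuous|exact: continuous_cos].
Qed.

Lemma continuous_sinM (s : R) : continuous (fun y : R => sin (y * s)).
Proof.
by move=> y; apply: continuous_comp; [exact: mulrr_continuous|exact: continuous_sin].
Qed.

Lemma normr_cos_le1 (x : R) : `|cos x| <= 1.
Proof. by rewrite ler_norml cos_geN1 cos_le1. Qed.

Lemma normr_sin_le1 (x : R) : `|sin x| <= 1.
Proof. by rewrite ler_norml sin_geN1 sin_le1. Qed.

Lemma integrable_abel_cos (e s : R) : 0 < e ->
  integrableT (fun y => abel e y * cos (y * s)).
Proof.
move=> e0; apply: (@integrable_abel_le e (fun y => cos (y * s)) 1) => // [|x].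
  exact: continuous_cosM.
exact: normr_cos_le1.
Qed.

Lemma integrable_abel_sin (e s : R) : 0 < e ->
  integrableT (fun y => abel e y * sin (y * s)).
Proof.
move=> e0; apply: (@integrable_abel_le e (fun y => sin (y * s)) 1) => // [|x].
  exact: continuous_sinM.
exact: normr_sin_le1.
Qed.

Lemma Rintegral_abel_cos (e s : R) : 0 < e ->
  \int[mu]_y (abel e y * cos (y * s)) = 2 * e / (e ^+ 2 + s ^+ 2).
Proof.
move=> e0; have := integral_abel_cosD s e0.
move=> /(congr1 fine); rewrite -[LHS]/(\int[mu]_y (abel e y * (1 + cos (y * s)))) /=.
under eq_Rintegral do rewrite mulrDr mulr1.
rewrite RintegralD//; [|exact: integrable_abel|exact: integrable_abel_cos].
have -> : \int[mu]_y abel e y = 2 / e by rewrite /Rintegral integral_abel.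
exact: addrI.
Qed.

Lemma Rintegral_abel_sin (e s : R) : 0 < e ->
  \int[mu]_y (abel e y * sin (y * s)) = 0.
Proof.
move=> e0; apply: Rintegral_odd.
- by move=> y; apply: cvgM; [exact: continuous_abel|exact: continuous_sinM].
- exact: integrable_abel_sin.
- by move=> y; rewrite /abel normrN mulNr sinN mulrN.
Qed.

Lemma fourier_pos_abel (e : R) : 0 < e -> fourier_pos (fun y => (abel e y)%:C).
Proof.
move=> e0; split.
- split; last exact: measurable_cst.
  exact: continuous_measurable_fun (@continuous_abel e).
- exists (abel e); first exact: integrable_abel.
  by move=> y; rewrite normcR ger0_norm// expR_ge0.
- move=> tau; under eq_Rintegral do rewrite Re_rM /= expR0 mul1r.
  rewrite Rintegral_abel_cos// divr_ge0 ?addr_ge0 ?sqr_ge0// mulr_ge0// ltW//.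
Qed.

End stable_density.

(** * Total mass of the stable kernel *)

Section stable_normalization.
Context {R : realType}.
Local Notation mu := (@lebesgue_measure R).
Local Notation integrableT f := (mu.-integrable setT (EFin \o f)).
Variable a : R.
Hypothesis a01 : 0 < a < 1.

Lemma monotone_cvgT (D : set R) (f_ : nat -> R -> R) (f : R -> R) :
  measurable D -> (forall n, measurable_fun D (f_ n)) ->
  (forall n x, D x -> 0 <= f_ n x) ->
  (forall x, D x -> {homo f_^~ x : n m / (n <= m)%N >-> n <= m}) ->
  (forall x, D x -> f_ n x @[n --> \oo] --> f x) ->
  (\int[mu]_(x in D) (f_ n x)%:E)%E @[n --> \oo] --> (\int[mu]_(x in D) (f x)%:E)%E.
Proof.
move=> mD mf f0 fnd fcvg.
have -> : (\int[mu]_(x in D) (f x)%:E =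
    \int[mu]_(x in D) limn (fun n => (f_ n x)%:E))%E.
  apply: eq_integral => x /set_mem Dx; apply/esym/cvg_lim => //.
  by apply: cvg_EFin; [exact: nearW|exact: fcvg].
apply: cvg_monotone_convergence => //.
by move=> n; apply/measurable_EFinP; exact: mf.
Qed.

Lemma cvg_abel1 (y : R) : abel n.+1%:R^-1 y @[n --> \oo] --> (1 : R).
Proof.
have h : - (n.+1%:R^-1 * `|y|) @[n --> \oo] --> (0 : R).
  rewrite -oppr0; apply: cvgN; under eq_fun do rewrite mulrC.
  by apply: cvg0_scale; exact: cvg_harmonic.
suff : expR (- (n.+1%:R^-1 * `|y|)) @[n --> \oo] --> expR (0 : R) by rewrite expR0.
exact: continuous_cvg (@continuous_expR R _) h.
Qed.

Lemma kerH_tilt (c t tau y : R) :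
  kerH a t tau (c +i* y) = (expR (c * tau))%:C * (kerH a t 0 (c +i* y) * cis (y * tau)).
Proof.
rewrite /kerH /cis -expcR -!expcD; congr expc; set p := powc _ a.
by apply: complex_eqP; rewrite !ReImE /=; ring.
Qed.

Lemma fourier_pos_stable (c t : R) : 0 < c -> 0 < t ->
  fourier_pos (fun y => kerH a t 0 (c +i* y)).
Proof.
move=> c0 t0; have [K K0 HK] := normc_kerH_maj a01 t0 0 c0.
apply: (@fourier_pos_lim R
  (fun n y => kerH a t 0 (c +i* y) * (abel n.+1%:R^-1 y)%:C) _ (fun y => K * inv1Dsqr y)).
- exact: integrable_inv1DsqrZ.
- move=> n; apply: (fourier_posM (pos_multiplier_stable a01 c0 t0)).
  by apply: fourier_pos_abel; rewrite invr_gt0 ltr0n.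
- move=> n y; rewrite ComplexField.Normc.normcM normcR ger0_norm ?expR_ge0//.
  apply: (@le_trans _ _ (normc (kerH a t 0 (c +i* y)))).
    rewrite ler_piMr ?normc_ge0// -expR0 ler_expR oppr_le0 mulr_ge0//.
  by apply: le_trans (HK _ _) _ => //=; rewrite mulr0 expR0 mul1r.
- move=> y; rewrite -[X in ccvg _ X]mulr1; apply: ccvgM; first exact: ccvg_cst.
  exact: (ccvg_real (@cvg_abel1 y)).
Qed.

(** Equals 2 pi exp (- c tau) times [pker]. Unlike the bound available for [pker], the one for this
    function is uniform in [tau], so the Abel factor suffices to make it integrable. *)
Definition stable_tilt (c t tau : R) : R :=
  \int[mu]_y Re (kerH a t 0 (c +i* y) * cis (y * tau)).

Lemma stable_tilt_ge0 (c t tau : R) : 0 < c -> 0 < t -> 0 <= stable_tilt c t tau.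
Proof. by move=> c0 t0; have [_ _] := fourier_pos_stable c0 t0; exact. Qed.

Lemma pkerE (c t tau : R) : 0 < c -> 0 < t ->
  pker c a t tau = (2 * pi)^-1 * (expR (c * tau) * stable_tilt c t tau).
Proof.
move=> c0 t0; have [mg [M iM gM] _] := fourier_pos_stable c0 t0.
rewrite /pker; under eq_Rintegral do rewrite kerH_tilt Re_rM.
by rewrite RintegralZl//; exact: fourier_integrable mg iM gM.
Qed.

Lemma pker_ge0 (c t tau : R) : 0 < c -> 0 < t -> 0 <= pker c a t tau.
Proof.
move=> c0 t0; rewrite pkerE// mulr_ge0 ?invr_ge0 ?mulr_ge0 ?expR_ge0 ?pi_ge0//.
exact: stable_tilt_ge0.
Qed.

Lemma continuous_stable_tilt (c t : R) : 0 < c -> 0 < t -> continuous (stable_tilt c t).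
Proof.
move=> c0 t0.
have -> : stable_tilt c t = fun tau => (2 * pi) * (expR (- (c * tau)) * pker c a t tau).
  apply/funext => tau; rewrite pkerE// expRN.
  have pi0 : pi != 0 :> R by rewrite gt_eqF// pi_gt0.
  have e0 : expR (c * tau) != 0 by rewrite gt_eqF// expR_gt0.
  by move: (pi : R) pi0 => p p0; field; rewrite e0 p0.
move=> tau; apply: cvgM; first exact: cvg_cst.
by apply: cvgM; [exact: continuous_expRM|exact: continuous_pker].
Qed.

Lemma normc_kerH0_le1 (c t y : R) : 0 < c -> 0 < t -> normc (kerH a t 0 (c +i* y)) <= 1.
Proof. by move=> c0 t0; have [_] := pos_multiplier_stable a01 c0 t0. Qed.

(** By Fubini the inner integral over [tau] is the Poisson kernel 2 e / (e^2 + y^2); its sine part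
    vanishes by oddness. Replacing [y] by e y moves [e] into the argument of [kerH] and leaves a
    fixed density, so that e -> 0 is a matter of dominated convergence. *)
Lemma integral_abel_stable_tilt (c t e : R) : 0 < c -> 0 < t -> 0 < e ->
  integrableT (fun tau => abel e tau * stable_tilt c t tau) /\
  \int[mu]_tau (abel e tau * stable_tilt c t tau) =
  \int[mu]_y (2 * Re (kerH a t 0 (c +i* (e * y))) * inv1Dsqr y).
Proof.
move=> c0 t0 e0.
have [mg [M iM gM] _] := fourier_pos_stable c0 t0.
have [cr ci] := continuous_kerH a t 0 c0.
set h := fun y => kerH a t 0 (c +i* y).
have M0 y : 0 <= M y by apply: le_trans (gM y); exact: normc_ge0.
have ih tau := fourier_integrable tau mg iM gM.
have bound (tau y : R) : `|Re (h y * cis (y * tau))| <= M y.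
  apply: le_trans (Re_le_normc _) _.
  by rewrite ComplexField.Normc.normcM normc_cis mulr1 gM.
split.
  apply: (@integrable_abel_le _ e _ (\int[mu]_y M y)) => //.
    exact: continuous_stable_tilt.
  move=> tau; rewrite /stable_tilt; apply: le_trans (le_normr_Rintegral _ (ih tau)) _ => //.
  apply: le_Rintegral => //.
    exact: integrable_norm (ih tau).
  by move=> y _; exact: bound.
have E1 : \int[mu]_tau (abel e tau * stable_tilt c t tau) =
    \int[mu]_tau \int[mu]_y (abel e tau * Re (h y * cis (y * tau))).
  by apply: eq_Rintegral => tau _; rewrite RintegralZl//; exact: ih.
rewrite E1 (@Fubini_dominated R (fun tau y => abel e tau * Re (h y * cis (y * tau)))
  (abel e) M); first last.
- by move=> tau y; rewrite normrM ger0_norm ?expR_ge0// ler_wpM2l ?expR_ge0.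
- exact: M0.
- by move=> tau; exact: expR_ge0.
- exact: iM.
- exact: integrable_abel.
- have m1 : measurable_fun setT (fun z : R * R => abel e z.1).
    by apply: measurableT_comp => //; exact: continuous_measurable_fun (@continuous_abel R e).
  have m2 : measurable_fun setT (fun z : R * R => Re (h z.2)).
    by apply: (measurableT_comp mg.1).
  have m3 : measurable_fun setT (fun z : R * R => Im (h z.2)).
    by apply: (measurableT_comp mg.2).
  have m4 : measurable_fun setT (fun z : R * R => z.2 * z.1).
    exact: measurable_funM.
  have m5 : measurable_fun setT (fun z : R * R => cos (z.2 * z.1)).
    by apply: measurableT_comp m4; apply: continuous_measurable_fun; exact: continuous_cos.
  have m6 : measurable_fun setT (fun z : R * R => sin (z.2 * z.1)).
    by apply: measurableT_comp m4; apply: continuous_measurable_fun; exact: continuous_sin.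
  apply: measurable_funM; first exact: m1.
  under eq_fun do rewrite Re_mul /= expR0 !mul1r.
  by apply: measurable_funB; exact: measurable_funM.
have E2 (y : R) : \int[mu]_tau (abel e tau * Re (h y * cis (y * tau))) =
    Re (h y) * (2 * e / (e ^+ 2 + y ^+ 2)).
  transitivity (\int[mu]_tau (Re (h y) * (abel e tau * cos (tau * y)) +
      (- Im (h y)) * (abel e tau * sin (tau * y)))).
    by apply: eq_Rintegral => tau _; rewrite Re_mul /= expR0 !mul1r [tau * y]mulrC; ring.
  rewrite RintegralD//; [|exact/integrableTZ/integrable_abel_cos|
                          exact/integrableTZ/integrable_abel_sin].
  rewrite !RintegralZl//; [|exact: integrable_abel_sin|exact: integrable_abel_cos].
  by rewrite Rintegral_abel_cos// Rintegral_abel_sin// mulr0 addr0.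
under eq_Rintegral do rewrite E2.
have cg : continuous (fun y : R => Re (h y) * (2 * e / (e ^+ 2 + y ^+ 2))).
  move=> y; apply: cvgM; first exact: cr.
  apply: cvgM; first exact: cvg_cst.
  apply: cvgV; first by rewrite gt_eqF// ltr_wpDr ?sqr_ge0// exprn_gt0.
  by apply: cvgD; [exact: cvg_cst|exact: exprn_continuous].
have ig : integrableT (fun y : R => Re (h y) * (2 * e / (e ^+ 2 + y ^+ 2))).
  apply: integrableT_continuous_le (integrableTZ (2 / e) iM) => // y.
  rewrite normrM mulrC; apply: ler_pM => //.
    rewrite ger0_norm; last first.
      by rewrite divr_ge0 ?addr_ge0 ?sqr_ge0// mulr_ge0// ltW.
    rewrite ler_pdivrMr ?ltr_wpDr ?sqr_ge0// ?exprn_gt0//.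
    rewrite mulrDr expr2 mulrA divfK ?gt_eqF// lerDl mulr_ge0 ?sqr_ge0//.
    by rewrite divr_ge0// ltW.
  exact: le_trans (Re_le_normc _) (gM y).
have [is_ sE] := Rintegral_scale e0 cg ig.
rewrite sE -RintegralZl//; apply: eq_Rintegral => y _; rewrite /inv1Dsqr /h.
set r := Re _; field.
by rewrite !lt0r_neq0// ?ltr_wpDr ?mulr_gt0 ?sqr_ge0 ?exprn_gt0.
Qed.

Lemma kerH0_real (c t : R) : 0 < c -> kerH a t 0 (c +i* 0) = (expR (- (t * c `^ a)))%:C.
Proof.
move=> c0; rewrite /kerH -[c +i* 0]/(c%:C) powcR// mulr0 sub0r -realCM -realCN.
exact: expcR.
Qed.

(** On the left, e -> 0 is monotone by positivity, since integrability is not yet known. On the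
    right it is dominated, since |h| <= 1, and the limit is 2 h(0) times the integral [pi] of
    [inv1Dsqr]. *)
Lemma integral_stable_tilt (c t : R) : 0 < c -> 0 < t ->
  (\int[mu]_tau (stable_tilt c t tau)%:E = (2 * pi * expR (- (t * c `^ a)))%:E)%E.
Proof.
move=> c0 t0; have [cr ci] := continuous_kerH a t 0 c0.
pose e (n : nat) : R := n.+1%:R^-1.
have e0 n : 0 < e n by rewrite invr_gt0 ltr0n.
have ecvg : e n @[n --> \oo] --> (0 : R) by exact: cvg_harmonic.
have lim1 : (\int[mu]_tau (abel (e n) tau * stable_tilt c t tau)%:E)%E @[n --> \oo] -->
    (\int[mu]_tau (stable_tilt c t tau)%:E)%E.
  apply: monotone_cvgT => //.
  - move=> n; apply: continuous_measurable_fun => x.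
    by apply: cvgM; [exact: continuous_abel|exact: continuous_stable_tilt].
  - by move=> n x _; rewrite mulr_ge0 ?expR_ge0// stable_tilt_ge0.
  - move=> x _ n m nm; rewrite ler_wpM2r ?stable_tilt_ge0//.
    rewrite ler_expR lerN2 ler_wpM2r// lef_pV2 ?posrE ?ltr0n//.
    by rewrite ler_nat.
  - move=> x _; rewrite -[X in _ --> X]mul1r; apply: cvgM; last exact: cvg_cst.
    exact: cvg_abel1.
have lim2 : \int[mu]_y (2 * Re (kerH a t 0 (c +i* (e n * y))) * inv1Dsqr y) @[n --> \oo] -->
    \int[mu]_y (2 * Re (kerH a t 0 (c +i* 0)) * inv1Dsqr y).
  have [||||_] // := @dominated_cvgT R
    (fun n y => 2 * Re (kerH a t 0 (c +i* (e n * y))) * inv1Dsqr y)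
    (fun y => 2 * Re (kerH a t 0 (c +i* 0)) * inv1Dsqr y) (fun y => 2 * inv1Dsqr y).
  - move=> n; apply: continuous_measurable_fun => y.
    apply: cvgM; last exact: continuous_inv1Dsqr.
    apply: cvgM; first exact: cvg_cst.
    apply: (@continuous_comp R R R ( *%R (e n)) (fun y => Re (kerH a t 0 (c +i* y)))).
      exact: mulrl_continuous.
    exact: cr.
  - move=> y; apply: cvgM; last exact: cvg_cst.
    apply: cvgM; first exact: cvg_cst.
    have en0 : e n * y @[n --> \oo] --> (0 : R).
      by rewrite -(mul0r y); apply: cvgM => //; exact: cvg_cst.
    exact: (cvg_comp _ _ en0 (cr 0)).
  - exact: integrable_inv1DsqrZ.
  - move=> n y.
    have : `|Re (kerH a t 0 (c +i* (e n * y)))| <= 1.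
      by apply: le_trans (Re_le_normc _) _; exact: normc_kerH0_le1.
    move: (Re _) => r r1; rewrite !normrM (ger0_norm (ltW (inv1Dsqr_gt0 _))) ger0_norm//.
    by rewrite -mulrA ler_pM2l// ler_piMl ?(ltW (inv1Dsqr_gt0 _)).
have lim2E : \int[mu]_y (2 * Re (kerH a t 0 (c +i* 0)) * inv1Dsqr y) =
    2 * pi * expR (- (t * c `^ a)).
  rewrite RintegralZl//; last exact: integrable_inv1Dsqr.
  rewrite kerH0_real//= /Rintegral integral_inv1Dsqr /=; ring.
have E n : (\int[mu]_tau (abel (e n) tau * stable_tilt c t tau)%:E =
    (\int[mu]_y (2 * Re (kerH a t 0 (c +i* (e n * y))) * inv1Dsqr y))%:E)%E.
  have [i <-] := integral_abel_stable_tilt c0 t0 (e0 n).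
  by rewrite /Rintegral fineK//; exact: integrable_fin_num.
move: lim1; under eq_fun do rewrite E; rewrite lim2E in lim2.
move/(cvg_lim (@ereal_hausdorff R)) => <-.
by apply/cvg_lim => //; apply: cvg_EFin; [exact: nearW|exact: lim2].
Qed.

(** Moving the line to abscissa [x] turns the weighted kernel into [stable_tilt x], whose integral
    is known. *)
Lemma integral_pker_tilt (c x t : R) : 0 < c -> 0 < x -> 0 < t ->
  (\int[mu]_tau (expR (- (x * tau)) * pker c a t tau)%:E = (expR (- (t * x `^ a)))%:E)%E.
Proof.
move=> c0 x0 t0.
have p0 : 0 < (2 * pi)^-1 :> R by rewrite invr_gt0 mulr_gt0// pi_gt0.
transitivity (\int[mu]_tau ((2 * pi)^-1%:E * (stable_tilt x t tau)%:E))%E.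
  apply: eq_integral => tau _; rewrite -EFinM (pker_indep a01 tau c0 x0 t0) pkerE//.
  congr (_%:E); rewrite mulrCA; congr (_ * _).
  by rewrite mulrA -expRD addNr expR0 mul1r.
rewrite ge0_integralZl//.
- rewrite integral_stable_tilt// -EFinM; congr (_%:E).
  by rewrite mulrA mulVf ?mul1r// gt_eqF// mulr_gt0// pi_gt0.
- by apply: continuous_measurable_EFin; exact: continuous_stable_tilt.
- by move=> tau _; rewrite lee_fin stable_tilt_ge0.
- by rewrite lee_fin ltW.
Qed.

(* Letting [x] tend to infinity in the previous lemma kills the half-line
   [tau <= 0]; letting [x] tend to [0] then gives the total mass. *)
Lemma integral_pker (c t : R) : 0 < c -> 0 < t ->
  (\int[mu]_(tau in `]0%R, +oo[) (pker c a t tau)%:E = 1)%E.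
Proof.
move=> c0 t0; have /andP[a0 a1] := a01.
pose g (x tau : R) := expR (- (x * tau)) * pker c a t tau.
have cg x : continuous (g x).
  by move=> y; apply: cvgM; [exact: continuous_expRM|exact: continuous_pker].
have g0 x tau : 0 <= g x tau by rewrite mulr_ge0 ?expR_ge0// pker_ge0.
have mg x (D : set R) : measurable_fun D (EFin \o g x).
  by apply: measurable_funTS; exact: continuous_measurable_EFin.
have split x : 0 < x -> ((expR (- (t * x `^ a)))%:E =
    \int[mu]_(tau in `]-oo, 0%R]) (g x tau)%:E +
    \int[mu]_(tau in `]0%R, +oo[) (g x tau)%:E)%E.
  move=> x0; rewrite -(integral_pker_tilt c0 x0 t0) -ge0_integral_setU//=.
  - by rewrite -setCitvr setvU.
  - exact: mg.
  - by move=> y _; rewrite lee_fin; exact: g0.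
  - rewrite disj_set2E; apply/eqP; rewrite -subset0 => y/=.
    by rewrite !in_itv/= andbT leNgt => -[/negP].
have A0 x : (0 <= \int[mu]_(tau in `]-oo, 0%R]) (g x tau)%:E)%E.
  by apply: integral_ge0 => y _; rewrite lee_fin.
have B0 x : (0 <= \int[mu]_(tau in `]0%R, +oo[) (g x tau)%:E)%E.
  by apply: integral_ge0 => y _; rewrite lee_fin.
(* For tau <= 0 the weight exp (- x tau) increases with [x], so the mass there at [x] is at most the
   one at [z], hence at most the total exp (- t z^a). *)
have Aexp x z : 0 < x -> x <= z ->
    (\int[mu]_(tau in `]-oo, 0%R]) (g x tau)%:E <= (expR (- (t * z `^ a)))%:E)%E.
  move=> x0 xz; rewrite (split z (lt_le_trans x0 xz)).
  apply: (@le_trans _ _ (\int[mu]_(tau in `]-oo, 0%R]) (g z tau)%:E)%E); last exact: leeDl.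
  apply: ge0_le_integral => //.
  - by move=> y _; rewrite lee_fin.
  - exact: mg.
  - exact: mg.
  move=> y; rewrite /= in_itv/= => y0; rewrite lee_fin ler_wpM2r ?pker_ge0//.
  by rewrite ler_expR lerN2 ler_wnM2r.
have A00 x : 0 < x -> (\int[mu]_(tau in `]-oo, 0%R]) (g x tau)%:E = 0)%E.
  move=> x0; apply/eqP; rewrite eq_le A0 andbT; apply/lee_addgt0Pr => e e0; rewrite add0e.
  (* This [z] forces t z^a >= 1 / e; together with exp u >= 1 + u this gives exp (- t z^a) <= e. *)
  pose z := Num.max x ((t * e)^-1 `^ a^-1).
  apply: le_trans (Aexp x z x0 _) _; first by rewrite le_max lexx.
  have te : 0 < t * e by rewrite mulr_gt0.
  have h : (t * e)^-1 <= z `^ a.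
    have -> : (t * e)^-1 = ((t * e)^-1 `^ a^-1) `^ a.
      by rewrite -powRrM mulVf ?gt_eqF// powRr1// invr_ge0 ltW.
    apply: ge0_ler_powR; rewrite ?nnegrE ?powR_ge0 ?(ltW a0)//.
      by rewrite le_max (ltW x0).
    by rewrite le_max lexx orbT.
  have h2 : e^-1 <= t * z `^ a.
    apply: (@le_trans _ _ (t * (t * e)^-1)); last by rewrite ler_pM2l.
    by rewrite invfM mulrA divff ?mul1r// gt_eqF.
  rewrite lee_fin expRN -[leRHS]invrK lef_pV2 ?posrE ?expR_gt0 ?invr_gt0//.
  apply: le_trans h2 _; apply: le_trans (expR_ge1Dx _); by rewrite lerDr.
have B1 x : 0 < x -> (\int[mu]_(tau in `]0%R, +oo[) (g x tau)%:E =
    (expR (- (t * x `^ a)))%:E)%E.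
  by move=> x0; rewrite (split x x0) A00// add0e.
pose e (n : nat) : R := n.+1%:R^-1.
have e0 n : 0 < e n by rewrite invr_gt0 ltr0n.
have lim1 : (\int[mu]_(tau in `]0%R, +oo[) (g (e n) tau)%:E)%E @[n --> \oo] -->
    (\int[mu]_(tau in `]0%R, +oo[) (pker c a t tau)%:E)%E.
  apply: monotone_cvgT => //.
  - by move=> n; apply: measurable_funTS; exact: continuous_measurable_fun.
  - move=> x; rewrite /= in_itv/= andbT => x0 n m nm.
    rewrite ler_wpM2r ?pker_ge0// ler_expR lerN2 ler_wpM2r ?(ltW x0)//.
    by rewrite lef_pV2 ?posrE ?ltr0n// ler_nat.
  - move=> x; rewrite /= in_itv/= andbT => x0.
    rewrite -[X in _ --> X]mul1r; apply: cvgM; last exact: cvg_cst.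
    by have := @cvg_abel1 x; rewrite /abel (gtr0_norm x0).
move/(cvg_lim (@ereal_hausdorff R)) : lim1 => <-.
under eq_fun do rewrite B1//.
apply/cvg_lim => //; apply: cvg_EFin; first exact: nearW.
have h : e n `^ a @[n --> \oo] --> (0 : R).
  by move/cvg_at_rightP : (powR_cvg0 a0) => /(_ e); apply; split => //; exact: cvg_harmonic.
have h2 : - (t * e n `^ a) @[n --> \oo] --> (0 : R).
  by rewrite -oppr0; apply: cvgN; exact: cvg0_scale.
suff : expR (- (t * e n `^ a)) @[n --> \oo] --> expR (0 : R) by rewrite expR0.
exact: continuous_cvg (@continuous_expR R _) h2.
Qed.

End stable_normalization.

(** * The kernels [phi] and [psi] *)

Section subordination.
Context {R : realType}.
Local Notation mu := (@lebesgue_measure R).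
Local Notation D := (`]0%R, +oo[%classic : set R).

(** Monotone convergence over growing compact intervals. It lets a substitution on compact intervals
    reach ]0, +oo[, for the original intervals and for their images alike. *)
Lemma ge0_integral_exhaust (f : R -> R) (lo hi : nat -> R) :
  measurable_fun D f -> (forall x, 0 < x -> 0 <= f x) -> (forall n, 0 < lo n) ->
  (forall n m, (n <= m)%N -> lo m <= lo n) -> (forall n m, (n <= m)%N -> hi n <= hi m) ->
  (forall x, 0 < x -> \forall n \near \oo, lo n <= x <= hi n) ->
  (\int[mu]_(x in `[lo n, hi n]) (f x)%:E)%E @[n --> \oo] -->
  (\int[mu]_(x in D) (f x)%:E)%E.
Proof.
move=> mf f0 lo0 ndlo ndhi ex.
have DE (x : R) : D x = (0 < x) :> Prop by rewrite /= in_itv/= andbT.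
have subD n : `[lo n, hi n]%classic `<=` D.
  by move=> x; rewrite /= !in_itv/= andbT => /andP[h _]; exact: lt_le_trans h.
have E n : (\int[mu]_(x in `[lo n, hi n]) (f x)%:E =
    \int[mu]_(x in D) ((f \_ `[lo n, hi n]) x)%:E)%E.
  rewrite -(setIidr (subD n)) integral_mkcondr.
  apply: eq_integral => x _; rewrite !patchE setIidr//.
  by case: ifP.
under eq_fun do rewrite E.
apply: monotone_cvgT => //.
- move=> n; apply: (iffLR (measurable_restrict f _ _)) => //.
  by apply: measurable_funS mf => //; exact: subIsetl.
- by move=> n x; rewrite DE => x0; rewrite patchE; case: ifP => // _; exact: f0.
- move=> x; rewrite DE => x0 n m nm; rewrite !patchE.
  case: ifPn => [|_]; last by case: ifP => // _; exact: f0.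
  rewrite inE/= in_itv/= => /andP[xl xh]; rewrite ifT// inE/= in_itv/=.
  by rewrite (le_trans (ndlo _ _ nm))// (le_trans xh)// ndhi.
- move=> x; rewrite DE => x0; apply: cvg_near_cst.
  by apply: filterS (ex x x0) => n h; rewrite patchE ifT// inE/= in_itv.
Qed.

(** The sign of [G] is controlled on the positive quadrant only, so Tonelli is applied on the plane
    to [G] times the indicators. *)
Lemma tonelli_pos (G : R -> R -> R) :
  measurable_fun setT (fun z : R * R => G z.1 z.2) ->
  (forall x y, 0 < x -> 0 < y -> 0 <= G x y) ->
  measurable_fun D (fun x => \int[mu]_(y in D) (G x y)%:E)%E /\
  (\int[mu]_(x in D) \int[mu]_(y in D) (G x y)%:E =
   \int[mu]_(y in D) \int[mu]_(x in D) (G x y)%:E)%E.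
Proof.
move=> mG G0.
have DE (x : R) : (x \in D) = (0 < x) by rewrite mem_setE in_itv/= andbT.
pose A (z : R * R) : \bar R := (G z.1 z.2 * \1_D z.1 * \1_D z.2)%:E.
have AE x y : A (x, y) = if (x \in D) && (y \in D) then (G x y)%:E else 0%E.
  rewrite /A /= !indicE; case: (x \in D); case: (y \in D);
  by rewrite /= ?mulr1 ?mulr0// mul0r.
have mI : measurable_fun setT (\1_D : R -> R) by exact: measurable_indic.
have mA : measurable_fun setT A.
  apply/measurable_EFinP; apply: measurable_funM; first apply: measurable_funM => //.
    exact: measurableT_comp mI measurable_fst.
  exact: measurableT_comp mI measurable_snd.
have A0 z : (0 <= A z)%E.
  case: z => x y; rewrite AE !DE; case: ifP => // /andP[x0 y0].
  by rewrite lee_fin G0.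
have intx x : (((fun x => \int[mu]_(y in D) (G x y)%:E) \_ D) x = \int[mu]_y A (x, y))%E.
  rewrite patchE; case: ifPn => xD.
    by rewrite integral_mkcond; apply: eq_integral => y _; rewrite AE xD patchE.
  by rewrite integral0_eq// => y _; rewrite AE (negbTE xD).
have inty y : (((fun y => \int[mu]_(x in D) (G x y)%:E) \_ D) y = \int[mu]_x A (x, y))%E.
  rewrite patchE; case: ifPn => yD.
    by rewrite integral_mkcond; apply: eq_integral => x _; rewrite AE yD andbT patchE.
  by rewrite integral0_eq// => x _; rewrite AE (negbTE yD) andbF.
split.
  apply: (iffRL (measurable_restrictT _ _)) => //.
  rewrite (_ : _ \_ _ = fun x => (\int[mu]_y A (x, y))%E); last exact/funext.
  exact: (@measurable_fun_fubini_tonelli_F _ _ _ _ _ mu A).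
rewrite integral_mkcond [RHS]integral_mkcond.
transitivity (\int[mu]_x \int[mu]_y A (x, y))%E.
  by apply: eq_integral => x _; exact: intx.
transitivity (\int[mu]_y \int[mu]_x A (x, y))%E; last first.
  by apply: eq_integral => y _; rewrite inty.
exact: (@fubini_tonelli _ _ _ _ _ mu mu A).
Qed.

Lemma density_kernel (g : R -> R[i]) (k : R -> R) :
  (forall x, 0 < x -> g x = (k x)%:C) -> (forall x, 0 < x -> 0 <= k x) ->
  measurable_fun D k -> (\int[mu]_(x in D) (k x)%:E = 1)%E ->
  kernel_nonneg (Fun_kernel g) /\ kernel_integral_eq1 (Fun_kernel g).
Proof.
move=> gk k0 mk k1.
have mD (x : R) : x \in D -> 0 < x by rewrite mem_setE in_itv/= andbT.
have Re_g : {in D, (fun x => Re (g x)) =1 k} by move=> x /mD x0; rewrite gk.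
have Im_g : {in D, (fun x => Im (g x)) =1 cst 0} by move=> x /mD x0; rewrite gk.
split; first by move=> x x0; rewrite gk// ler0c k0.
split; [split|apply: complex_eqP => /=].
- have ik : mu.-integrable D (EFin \o k).
    apply/integrableP; split; first exact/measurable_EFinP.
    rewrite (_ : (\int[mu]_(x in D) _)%E = 1%E) ?ltry//.
    rewrite -k1; apply: eq_integral => x /mD x0.
    by rewrite /= ger0_norm// k0.
  by apply: eq_integrable ik => // x xD /=; rewrite Re_g.
- have i0 : mu.-integrable D (cst 0%E) by exact: integrable0.
  by apply: eq_integrable i0 => // x xD /=; rewrite Im_g.
- by transitivity (\int[mu]_(x in D) k x); [exact: eq_Rintegral|rewrite /Rintegral k1].
- by transitivity (\int[mu]_(x in D) cst 0 x); [exact: eq_Rintegral|rewrite /Rintegral integral0].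
Qed.

(** A partial integral may be infinite at some points, where [fine] returns 0. Since [E] has total
    integral 1, these points form a null set and the integral is unchanged. *)
Lemma density_kernel_fine (g : R -> R[i]) (E : R -> \bar R) :
  (forall x, 0 < x -> g x = (fine (E x))%:C) -> (forall x, 0 < x -> (0 <= E x)%E) ->
  measurable_fun D E -> (\int[mu]_(x in D) E x = 1)%E ->
  kernel_nonneg (Fun_kernel g) /\ kernel_integral_eq1 (Fun_kernel g).
Proof.
move=> gE E0 mE E1.
have iE : mu.-integrable D E.
  apply/integrableP; split; first exact: mE.
  rewrite (_ : (\int[mu]_(x in D) _)%E = 1%E) ?ltry// -E1.
  apply: eq_integral => x; rewrite mem_setE in_itv/= andbT => x0.
  by rewrite gee0_abs// E0.
have mfE : measurable_fun D (fun x => fine (E x)).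
  by apply: measurableT_comp mE.
have mfE' : measurable_fun D (EFin \o (fun x => fine (E x))) by exact/measurable_EFinP.
apply: (density_kernel gE _ mfE) => [x x0|]; first exact/fine_ge0/E0.
rewrite -E1; apply: ae_eq_integral; [exact: measurable_itv|exact: mfE'|exact: mE|].
apply: filterS (integrable_ae _ iE) => // x h xD.
by rewrite fineK// h.
Qed.

(** * The density phi as an image of the stable density *)

Section phi_density.
Variables (b c t : R).
Hypotheses (b01 : 0 < b < 1) (c0 : 0 < c) (t0 : 0 < t).

Definition phi_density (s : R) : R := t / (b * s) * pker c b s t.

Let b0 : 0 < b. Proof. by case/andP: b01. Qed.

Lemma phi_density_ge0 (s : R) : 0 < s -> 0 <= phi_density s.
Proof.
move=> s0; apply: mulr_ge0; last exact: (pker_ge0 b01 _ c0 s0).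
by rewrite divr_ge0 ?mulr_ge0 ?(ltW t0) ?(ltW b0) ?(ltW s0).
Qed.

Let F (s : R) := t * s `^ (- b^-1).

Let dF (s : R) := t * (- b^-1 * s `^ (- b^-1 - 1)).

Lemma is_derive_stable_scale (s : R) : 0 < s -> is_derive s 1 F (dF s).
Proof.
move=> s0.
apply: is_derive_eq (is_derive_mul (is_derive_cst t s 1) (is_derive1_powR _ s0)) _.
by rewrite /= mul0r add0r.
Qed.

(** Scaling gives pker at (s, t) as s^(- 1 / b) times pker at (1, F s), and t / (b s) s^(- 1 / b) is
    exactly - F'(s). If S has the stable density at time 1, this is the density of (t / S)^b. *)
Lemma phi_densityE (s : R) : 0 < s -> phi_density s = pker c b 1 (F s) * - dF s.
Proof.
move=> s0; rewrite /phi_density (pker_scale b01 t c0 c0 s0) -/(F s) /dF.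
rewrite powRD; last by rewrite (gt_eqF s0) implybT.
rewrite powR_inv1 ?(ltW s0)//.
set p := pker _ _ _ _; set q := _ `^ _.
by field; rewrite !gt_eqF.
Qed.

Lemma stable_scale_lt (s s' : R) : 0 < s -> s < s' -> F s' < F s.
Proof.
move=> s0 ss; have s'0 := lt_trans s0 ss.
rewrite ltr_pM2l// !powRN ltf_pV2 ?posrE ?powR_gt0//.
by rewrite gt0_ltr_powR ?invr_gt0// nnegrE ltW.
Qed.

Lemma stable_scale_le (s s' : R) : 0 < s -> s <= s' -> F s' <= F s.
Proof.
by move=> s0; rewrite le_eqVlt => /predU1P[->//|h]; exact/ltW/stable_scale_lt.
Qed.

Lemma stable_scale_surj (u : R) : 0 < u -> exists2 s, 0 < s & F s = u.
Proof.
move=> u0; exists ((u / t) `^ (- b)); first by rewrite powR_gt0// divr_gt0.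
rewrite /F -powRrM mulrNN divff ?gt_eqF// powRr1 ?divr_ge0 ?(ltW u0) ?(ltW t0)//.
by rewrite mulrC divfK// gt_eqF.
Qed.

Lemma continuous_dF (s : R) : 0 < s -> {for s, continuous dF}.
Proof.
move=> s0; apply: cvgM; first exact: cvg_cst.
apply: cvgM; first exact: cvg_cst.
exact: is_derive_continuous (is_derive1_powR (- b^-1 - 1) s0).
Qed.

Lemma measurable_phi_density : measurable_fun D phi_density.
Proof.
apply: (eq_measurable_fun (fun s => pker c b 1 (F s) * - dF s)).
  by move=> s; rewrite mem_setE in_itv/= andbT => s0; rewrite phi_densityE.
apply: measurable_funTS; apply: measurable_funM.
  apply: (@measurableT_comp _ _ _ _ _ _ (pker c b 1)).
    by apply: continuous_measurable_fun; exact: continuous_pker.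
  by apply: measurable_funM => //; exact: measurable_powR.
apply: measurable_funN; apply: measurable_funM => //.
by apply: measurable_funM => //; exact: measurable_powR.
Qed.

Lemma integral_phi_density : (\int[mu]_(s in D) (phi_density s)%:E = 1)%E.
Proof.
have cP : continuous (pker c b 1) by exact: continuous_pker.
have P0 x : 0 <= pker c b 1 x by exact: pker_ge0.
pose lo (n : nat) : R := n.+1%:R^-1; pose hi (n : nat) : R := n.+1%:R.
have lo0 n : 0 < lo n by rewrite invr_gt0 ltr0n.
have lohi n : lo n <= hi n.
  by apply: (@le_trans _ _ 1); [rewrite invf_le1 ?ltr0n// ler1n|rewrite ler1n].
have hi0 n : 0 < hi n by rewrite ltr0n.
have ndlo n m : (n <= m)%N -> lo m <= lo n.
  by move=> nm; rewrite lef_pV2 ?posrE ?ltr0n// ler_nat.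
have ndhi n m : (n <= m)%N -> hi n <= hi m by move=> nm; rewrite ler_nat.
have ex (x : R) : 0 < x -> \forall n \near \oo, lo n <= x <= hi n.
  move=> x0; near=> n; apply/andP; split.
    rewrite -[leRHS]invrK lef_pV2 ?posrE ?invr_gt0 ?ltr0n//.
    rewrite (@le_trans _ _ n%:R)// ?ler_nat//.
    by near: n; exact: nbhs_infty_ger.
  rewrite (@le_trans _ _ n%:R)// ?ler_nat//.
  by near: n; exact: nbhs_infty_ger.
have lim1 := ge0_integral_exhaust measurable_phi_density phi_density_ge0 lo0 ndlo ndhi ex.
have F0 s : 0 < s -> 0 < F s by move=> s0; rewrite mulr_gt0// powR_gt0.
have lim2 : (\int[mu]_(x in `[F (hi n), F (lo n)]) (pker c b 1 x)%:E)%E @[n --> \oo] -->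
    (\int[mu]_(x in D) (pker c b 1 x)%:E)%E.
  apply: ge0_integral_exhaust => //.
  - by apply: measurable_funTS; exact: continuous_measurable_fun.
  - by move=> n; exact: F0.
  - by move=> n m nm; apply: stable_scale_le => //; exact: ndhi.
  - by move=> n m nm; apply: stable_scale_le => //; exact: ndlo.
  - move=> x x0; have [s s0 <-] := stable_scale_surj x0.
    apply: filterS (ex s s0) => n /andP[h1 h2].
    by rewrite !stable_scale_le.
have pos n s : s \in `]lo n, hi n[ -> 0 < s.
  by rewrite in_itv/= => /andP[h _]; exact: lt_trans h.
have pos' n s : s \in `[lo n, hi n] -> 0 < s.
  by rewrite in_itv/= => /andP[h _]; exact: lt_le_trans h.
have d1 (s : R) : 0 < s -> derive1 F s = dF s.
  by move=> s0; rewrite derive1E; have d := is_derive_stable_scale s0; exact: derive_val.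
have cd1 (s : R) : 0 < s -> {for s, continuous (derive1 F)}.
  move=> s0; suff : derive1 F u @[u --> s] --> dF s by rewrite -(d1 s s0).
  apply: cvg_trans (continuous_dF s0); apply: near_eq_cvg.
  near=> u; rewrite d1//; near: u; exact: lt_nbhsr.
(* [F] is decreasing: the endpoints are exchanged, and the Jacobian - F' is the factor found in
   [phi_densityE]. *)
have subst n : (\int[mu]_(x in `[F (hi n), F (lo n)]) (pker c b 1 x)%:E =
    \int[mu]_(s in `[lo n, hi n]) (phi_density s)%:E)%E.
  rewrite (@integration_by_substitution_decreasing _ F _ (lo n) (hi n))//.
  - apply: eq_integral => s; rewrite inE/= => /pos' s0.
    by rewrite phi_densityE// /= !fctE d1.
  - by move=> x y _ /pos' y0; exact: stable_scale_lt.
  - by move=> s /pos s0; exact: cd1.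
  - by apply/cvg_ex; exists (derive1 F (lo n)); apply: cvg_at_right_filter; exact: cd1.
  - by apply/cvg_ex; exists (derive1 F (hi n)); apply: cvg_at_left_filter; exact: cd1.
  - split.
    + by move=> s /pos s0; have d := is_derive_stable_scale s0; exact: ex_derive.
    + by apply: cvg_at_right_filter; exact: is_derive_continuous (is_derive_stable_scale (lo0 n)).
    + by apply: cvg_at_left_filter; exact: is_derive_continuous (is_derive_stable_scale (hi0 n)).
  - exact: continuous_subspaceT.
move: lim2; under eq_fun do rewrite subst.
move/(cvg_lim (@ereal_hausdorff R)) => h.
by rewrite -(integral_pker b01 c0 ltr01) -h; apply/esym/cvg_lim.
Unshelve. all: by end_near. Qed.

End phi_density.

(** * The subordination kernel *)

Section subordination_density.
Variables (a b cf cphi t : R).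
Hypotheses (a01 : 0 < a < 1) (b01 : 0 < b < 1).
Hypotheses (cf0 : 0 < cf) (cphi0 : 0 < cphi) (t0 : 0 < t).

Lemma subordination_kernel_density :
  kernel_nonneg (Fun_kernel (subordination_kernel cf cphi a b t)) /\
  kernel_integral_eq1 (Fun_kernel (subordination_kernel cf cphi a b t)).
Proof.
have DE (x : R) : (x \in D) = (0 < x) by rewrite mem_setE in_itv/= andbT.
pose G (tau s : R) := phi_density b cphi t s * pker cf a s tau.
have G0 tau s : 0 < tau -> 0 < s -> 0 <= G tau s.
  by move=> _ s0; rewrite mulr_ge0 ?phi_density_ge0// pker_ge0.
(* Agrees with [G] for s > 0, but is visibly measurable in both variables on the whole plane: after
   scaling it is built from a continuous function of one variable, a power of [s], and [phi_density]
   cut off outside the half-line. *)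
pose G' (tau s : R) := (phi_density b cphi t \_ D) s *
  (s `^ (- a^-1) * pker cf a 1 (tau * s `^ (- a^-1))).
have GG' tau s : 0 < s -> G tau s = G' tau s.
  by move=> s0; rewrite /G /G' patchE DE s0 (pker_scale a01 tau cf0 cf0 s0).
have mG' : measurable_fun setT (fun z : R * R => G' z.1 z.2).
  have mpow : measurable_fun setT (fun z : R * R => z.2 `^ (- a^-1)).
    exact: measurableT_comp (measurable_powR _) measurable_snd.
  apply: measurable_funM.
    apply: measurableT_comp measurable_snd.
    apply: (iffLR (measurable_restrictT _ _)) => //; exact: measurable_phi_density.
  apply: measurable_funM => //.
  apply: (@measurableT_comp _ _ _ _ _ _ (pker cf a 1)); last exact: measurable_funM.
  by apply: continuous_measurable_fun; exact: continuous_pker.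
have G'0 tau s : 0 < tau -> 0 < s -> 0 <= G' tau s.
  by move=> tau0 s0; rewrite -GG'// G0.
have [mE swap] := tonelli_pos mG' G'0.
pose E (tau : R) := (\int[mu]_(s in D) (G' tau s)%:E)%E.
have E0 tau : 0 < tau -> (0 <= E tau)%E.
  by move=> tau0; apply: integral_ge0 => s /mem_set; rewrite DE => s0; rewrite lee_fin G'0.
have E1 : (\int[mu]_(tau in D) E tau = 1)%E.
  rewrite /E swap -(integral_phi_density b01 cphi0 t0).
  apply: eq_integral => s; rewrite DE => s0.
  transitivity (\int[mu]_(tau in D) ((phi_density b cphi t s)%:E * (pker cf a s tau)%:E))%E.
    by apply: eq_integral => tau _; rewrite -GG'// EFinM.
  have mP : measurable_fun D (fun tau => (pker cf a s tau)%:E).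
    by apply: measurable_funTS; apply: continuous_measurable_EFin; exact: continuous_pker.
  have P0 tau : D tau -> (0 <= (pker cf a s tau)%:E)%E.
    by move=> _; rewrite lee_fin; exact: (pker_ge0 a01 tau cf0 s0).
  have phi0 : (0 <= (phi_density b cphi t s)%:E)%E.
    by rewrite lee_fin; exact: phi_density_ge0.
  have mD : measurable D by exact: measurable_itv.
  apply: etrans (ge0_integralZl mu mD mP P0 phi0) _.
  by rewrite (integral_pker a01 cf0 s0) mule1.
apply: (@density_kernel_fine _ E _ E0 mE E1).
move=> tau tau0; rewrite /subordination_kernel /cintegral.
have gE s : s \in D -> phi_kernel cphi b t s * f_kernel cf a s tau = (G tau s)%:C.
  rewrite DE => s0; rewrite (phi_kernelE b01 t cphi0 s0) (f_kernelE a01 tau cf0 s0).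
  exact/esym/realCM.
rewrite -[RHS]complexr0; congr (_ +i* _).
  rewrite /Rintegral; congr fine; apply: eq_integral => s sD.
  have s0 : 0 < s by rewrite -DE.
  by rewrite (gE s sD); exact: (congr1 (@EFin R) (GG' tau s s0)).
apply: (congr1 fine (y := 0%E)); apply: integral0_eq => s /mem_set sD.
by rewrite (gE s sD).
Qed.

End subordination_density.
End subordination.

Theorem proposition2p2 (R : realType) (alpha beta : R)
    (halpha : 0 < alpha <= 1) (hbeta : 0 < beta <= 1)
    (cf cphi : R) (hcf : 0 < cf) (hcphi : 0 < cphi)
    (t : R) (ht : 0 < t) :
  kernel_nonneg (psi cf cphi alpha beta t) /\
  kernel_integral_eq1 (psi cf cphi alpha beta t).
Proof.
have /andP[a0 a1] := halpha; have /andP[b0 b1] := hbeta.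
rewrite /psi; case: eqP => [_|/eqP a_neq1]; case: eqP => [_|/eqP b_neq1].
- split=> [A mA _|]; first exact: measure_ge0.
  by rewrite /= diracE mem_set//= in_itv/= ht.
- have b01 : 0 < beta < 1 by rewrite b0 lt_neqAle b_neq1.
  apply: (density_kernel (k := phi_density beta cphi t)).
  + by move=> s s0; exact: phi_kernelE.
  + exact: phi_density_ge0.
  + exact: measurable_phi_density.
  + exact: integral_phi_density.
- have a01 : 0 < alpha < 1 by rewrite a0 lt_neqAle a_neq1.
  apply: (density_kernel (k := pker cf alpha t)).
  + by move=> s s0; exact: f_kernelE.
  + by move=> s _; exact: pker_ge0.
  + by apply: measurable_funTS; apply: continuous_measurable_fun; exact: continuous_pker.
  + exact: integral_pker.
- have a01 : 0 < alpha < 1 by rewrite a0 lt_neqAle a_neq1.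
  have b01 : 0 < beta < 1 by rewrite b0 lt_neqAle b_neq1.
  exact: subordination_kernel_density.
Qed.
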